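(* Let $k\ge0$ be a fixed integer, $\mathcal E$ a finite-dimensional Hilbert space and $\theta\in B(\mathcal E,F^2(H_n)\otimes\mathcal E)$. The following are equivalent: (i) $\theta$ is outer; (ii) $\theta(0)$ is invertible and for every $\psi\in B(\mathcal E,F^2(H_n)\otimes\mathcal E)$ with $K_\psi=K_\theta$, $\|\mathbb P_kM_\psi p\|\le\|\mathbb P_kM_\theta p\|$ for all $p\in\mathcal P_k(\mathcal E)$; (iii) $\theta(0)$ is invertible and $\Delta_{K_\theta}=\theta(0)^*\theta(0)$; (iv) $\theta(0)$ is invertible and $e(K_\theta)=\ln\det[\theta(0)^*\theta(0)]$. In particular, $f\in F^2(H_n)$ is outer if and only if $f(0)\ne0$ and $e(K_f)=\ln|f(0)|^2$.
   Context: Full Fock space $F^2(H_n)$, basis $e_\alpha$ ($\alpha\in\mathbb F_n^+$, identity $g_0$, $e_{g_0}=1$), $S_i\psi=e_i\otimes\psi$, $S_\alpha$ products. $\mathcal E\equiv1\otimes\mathcal E$, and $\theta(0)=P_{\mathcal E}\theta\in B(\mathcal E)$. $\theta$ is outer if $\bigvee_\alpha(S_\alpha\otimes I)\theta\mathcal E=F^2(H_n)\otimes\mathcal E$. $M_\theta$ denotes the map on polynomials $M_\theta(\sum_{|\alpha|\le m}e_\alpha\otimes h_\alpha)=\sum(S_\alpha\otimes I)\theta h_\alpha$. $K_\theta(\sigma,\omega)\in B(\mathcal E)$ is defined by $\langle K_\theta(\sigma,\omega)h,h'\rangle=\langle(S_\omega\otimes I)\theta h,(S_\sigma\otimes I)\theta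 h'\rangle$. $\mathcal P_k(\mathcal E)=\bigoplus_{|\alpha|\le k}e_\alpha\otimes\mathcal E$ and $\mathbb P_k$ is the orthogonal projection onto it. For a kernel $K$, $\langle\Delta_Kh,h\rangle=\inf\sum_{\sigma,\omega}\langle K(\omega,\sigma)h_\sigma,h_\omega\rangle$ over finitely supported $\{h_\sigma\}\subset\mathcal E$ with $h_{g_0}=h$, and $e(K)=\ln\det\Delta_K$. For $f\in F^2(H_n)$ (case $\mathcal E=\mathbb C$), $f(0)=\langle f,1\rangle$. *)

(* Defs.v *)
From mathcomp Require Import all_boot all_algebra complex.
From mathcomp Require Import all_classical all_reals all_analysis.
Import GRing.Theory Num.Theory.
Set Implicit Arguments. Unset Strict Implicit. Unset Printing Implicit Defensive.
Local Open Scope ring_scope.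
Local Open Scope complex_scope.

Section Fock.
Variables (R : realType) (n d : nat).
Local Notation C := R[i].
Definition word := seq 'I_n.
(* E = C^d (column vectors); F^2(H_n) (x) E = l^2 functions word -> E *)
Definition vecE := 'cV[C]_d.
Definition fockE := word -> vecE.

Definition sqnormE (v : vecE) : R :=
  \sum_(i < d) (complex.Re (v i 0) ^+ 2 + complex.Im (v i 0) ^+ 2).

Definition sqnorm (f : fockE) : \bar R :=
  (\sum_(m <oo) (\sum_(t : m.-tuple 'I_n) sqnormE (f (val t)))%:E)%E.

Definition inFock (f : fockE) : Prop := (sqnorm f < +oo)%E.

Definition fadd (f g : fockE) : fockE := fun a => f a + g a.
Definition fopp (f : fockE) : fockE := fun a => - f a.
Definition fscale (c : C) (f : fockE) : fockE := fun a => c *: f a.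

(* inner product <f,g> (linear in f), by polarization of the norm *)
Definition ip (f g : fockE) : C :=
  4^-1 * \sum_(k < 4) ('i ^+ k * (fine (sqnorm (fadd f (fscale ('i ^+ k) g))))%:C).

Definition sum_upto (V : nmodType) (m : nat) (F : word -> V) : V :=
  \sum_(i < m.+1) \sum_(t : i.-tuple 'I_n) F (val t).

(* (S_alpha (x) I) f : e_beta (x) h |-> e_(alpha beta) (x) h *)
Definition shiftw (a : word) (f : fockE) : fockE :=
  fun b => if prefix a b then f (drop (size a) b) else 0.

(* theta in B(E, F^2(H_n) (x) E), E = C^d, is given by theta : word -> 'M_d,
   (theta h)(beta) = theta beta *m h *)
Definition opE := word -> 'M[C]_d.
Definition app (theta : opE) (h : vecE) : fockE := fun b => theta b *m h.
Definition bounded_op (theta : opE) : Prop := forall h, inFock (app theta h).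
Definition at0 (theta : opE) : 'M[C]_d := theta [::].

(* polynomials sum_{|alpha|<=m} e_alpha (x) h_alpha : given by (m, hs) *)
Definition Mop (theta : opE) (m : nat) (hs : word -> vecE) : fockE :=
  fun b => sum_upto m (fun a => shiftw a (app theta (hs a)) b).

(* outer: closed span of (S_alpha (x) I) theta E is everything *)
Definition outer (theta : opE) : Prop :=
  forall g : fockE, inFock g -> forall eps : R, 0 < eps ->
    exists m (hs : word -> vecE),
      (sqnorm (fadd g (fopp (Mop theta m hs))) < (eps ^+ 2)%:E)%E.

Definition Pk (k : nat) (f : fockE) : fockE :=
  fun b => if (size b <= k)%N then f b else 0.

Definition basis (l : 'I_d) : vecE := delta_mx l 0.
Definition adjM (p q : nat) (A : 'M[C]_(p, q)) : 'M[C]_(q, p) := map_mx conjc A^T.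

(* kernel K_theta(sigma, omega) : <K(s,w) h, h'> = <S_w theta h, S_s theta h'> *)
Definition kernel := word -> word -> 'M[C]_d.
Definition Kth (theta : opE) : kernel :=
  fun s w => \matrix_(j, l) ip (shiftw w (app theta (basis l))) (shiftw s (app theta (basis j))).

(* <Delta_K h, h> = inf sum_{s,w} <K(w,s) h_s, h_w>, finitely supported, h_{g0} = h *)
Definition DeltaQ (K : kernel) (h : vecE) : R :=
  inf [set x : R | exists (m : nat) (hs : word -> vecE), hs [::] = h /\
        x = complex.Re (sum_upto m (fun s => sum_upto m (fun w =>
              (adjM (hs w) *m K w s *m hs s) 0 0)))].

(* the operator Delta_K, recovered from its quadratic form by polarization *)
Definition Delta (K : kernel) : 'M[C]_d :=
  \matrix_(j, l) (4^-1 * \sum_(k < 4)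
      ('i ^+ k * (DeltaQ K (basis l + ('i ^+ k) *: basis j))%:C)).

Definition eK (K : kernel) : \bar R :=
  let D := complex.Re (\det (Delta K)) in
  if 0 < D then (ln D)%:E else (-oo)%E.

End Fock.

Definition scal_op (R : realType) (n : nat) (f : seq 'I_n -> R[i]) : opE R n 1 :=
  fun a => (f a)%:M.

(* Main.v *)
Require Import Defs.
From mathcomp Require Import all_boot all_order all_algebra complex ring lra.
From mathcomp Require Import all_classical all_reals all_analysis.
Import Order.TTheory GRing.Theory Num.Theory numFieldNormedType.Exports.
Set Implicit Arguments. Unset Strict Implicit. Unset Printing Implicit Defensive.
Local Open Scope classical_set_scope.
Local Open Scope ring_scope.
Local Open Scope complex_scope.

(* In one direction, an outer theta approximates (I - P_k) M_theta p by polynomials of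
   order greater than k, so that P_k M_psi p is a truncation of elements whose norm is
   that of P_k M_theta p up to epsilon.  Conversely, Delta_K(h) is the squared norm of
   the projection W h of theta h onto the wandering subspace of the closure of the range
   of M_theta, and W(0) = theta(0), so theta(0)^* theta(0) <= Delta_K.  When theta(0) is
   invertible, write Delta_K = B^* B; then U = W B^-1 is inner, theta = U psi for a psi
   with psi(0) = B, and K_psi = K_theta.  Testing the maximality of theta against psi on
   e_a (x) h with |a| = k forces Delta_K = theta(0)^* theta(0).  Equality of the
   determinants also forces this, and it says that W h = e_(g_0) (x) theta(0) h: the
   closure of the range of M_theta then contains the constants, hence everything. *)

(** M_theta need not extend to a bounded operator, so it is applied to polynomials and formal
    series, and the boundedness of psi has to be earned. Removing the first letter of words splits
    norms, products and closures into a constant term and one piece per letter, which turns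
    statements about degree k into inductions. The closures are graded by the order of the
    polynomials, and invertibility of theta(0) makes this grading visible on coefficients: an
    element of the closed range whose coefficients vanish below degree k is a limit of M_theta q
    with q of order at least k. Both directions separate low from high degrees in this way. The
    operator psi is the formal quotient of theta by U, which exists because U(0) = theta(0) B^-1 is
    invertible. The identity |M_psi p| = |M_theta p| on polynomials then yields at once that psi is
    bounded and, by polarization, that K_psi = K_theta. *)

Lemma sqr_le_of_quadratic_ge0 (R : realFieldType) (a b c : R) : 0 <= c ->
  (forall t, 0 <= a + 2 * t * b + t ^+ 2 * c) -> b ^+ 2 <= a * c.
Proof.
rewrite le_eqVlt => /predU1P[<-|c0] H.
  have [->|b0] := eqVneq b 0; first by rewrite expr0n mulr0.
  (* For [c = 0] the expression is affine in t, and this t would give it the value -1. *)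
  have := H (- (a + 1) / (2 * b)); rewrite mulr0 addr0.
  by have -> : 2 * (- (a + 1) / (2 * b)) * b = - (a + 1) by [field]; lra.
have := H (- b / c).
have -> : a + 2 * (- b / c) * b + (- b / c) ^+ 2 * c = (a * c - b ^+ 2) / c.
  by field; rewrite gt_eqF.
by rewrite pmulr_lge0 ?invr_gt0 // subr_ge0.
Qed.

Lemma sum_tupleS (V : nmodType) (T : finType) (F : seq T -> V) k :
  \sum_(t : k.+1.-tuple T) F t = \sum_x \sum_(t : k.-tuple T) F (x :: t).
Proof.
rewrite pair_big /= (reindex (fun p : T * k.-tuple T => [tuple of p.1 :: p.2])) //=.
exists (fun t => (thead t, [tuple of behead t])) => [[x t] _|t _] /=.
  by rewrite theadE; congr (_, _); apply: val_inj.
by rewrite -tuple_eta.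
Qed.

Lemma sum_tuple0 (V : nmodType) (T : finType) (F : seq T -> V) :
  \sum_(t : 0.-tuple T) F t = F [::].
Proof.
rewrite (bigD1 [tuple]) //= big1 ?addr0 // => t.
by rewrite -(tuple0 t) eqxx.
Qed.

(** The adjoint of left creation by [x], that is, the left quotient of a series by a letter. *)
Definition der (T A : Type) (x : T) (f : seq T -> A) : seq T -> A := fun b => f (x :: b).

(** * The real Hilbert space structure of the Fock space *)

Section FockSpace.
Variables (R : realType) (n d : nat).
Local Notation C := R[i].
Local Notation V := (seq 'I_n -> 'cV[C]_d).
Implicit Types (f g h : V) (c : C) (u v : 'cV[C]_d).

(* The real part of the inner product; complex orthogonality is orthogonality for
   [redot] to all complex multiples. *)
Definition redot (u v : 'cV[C]_d) : R :=
  \sum_(i < d) (complex.Re (u i 0) * complex.Re (v i 0)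
              + complex.Im (u i 0) * complex.Im (v i 0)).

Lemma redotC u v : redot u v = redot v u.
Proof. by apply: eq_bigr => i _; rewrite mulrC [X in _ + X]mulrC. Qed.

Lemma redotDl u u' v : redot (u + u') v = redot u v + redot u' v.
Proof.
rewrite -big_split; apply: eq_bigr => i _; rewrite !mxE /=.
by case: (u i 0) (u' i 0) (v i 0) => a b [a' b'] [a'' b''] /=; ring.
Qed.

Lemma redotZl c u v : redot (c *: u) v = redot u (conjc c *: v).
Proof.
apply: eq_bigr => i _; rewrite !mxE /=.
by case: (u i 0) (v i 0) c => a b [a' b'] [a'' b''] /=; ring.
Qed.

Lemma redotZr (x : R) u v : redot (x%:C *: u) v = x * redot u v.
Proof.
rewrite mulr_sumr; apply: eq_bigr => i _; rewrite !mxE /=.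
by case: (u i 0) (v i 0) => a b [a' b'] /=; ring.
Qed.

Lemma redot_sqnormE u : redot u u = sqnormE u.
Proof. by apply: eq_bigr => i _; rewrite !expr2. Qed.

Lemma redot_ge0 u : 0 <= redot u u.
Proof. by rewrite redot_sqnormE; apply: sumr_ge0 => i _; rewrite addr_ge0 ?sqr_ge0. Qed.

Lemma redot0l v : redot 0 v = 0.
Proof. by apply: big1 => i _; rewrite !mxE /=; ring. Qed.

Lemma redot_eq0 u : redot u u <= 0 -> u = 0.
Proof.
move=> u0; have {}u0 : redot u u == 0 by rewrite eq_le u0 redot_ge0.
move: u0; rewrite psumr_eq0 => [/allP H|i _]; last by rewrite -!expr2 addr_ge0 ?sqr_ge0.
apply/colP => i; rewrite mxE; have := H i (mem_index_enum i); rewrite /= -!expr2.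
rewrite paddr_eq0 ?sqr_ge0 // !sqrf_eq0.
by case: (u i 0) => a b /= /andP [/eqP -> /eqP ->].
Qed.

Lemma redot_coord u i :
  complex.Re (u i 0) ^+ 2 <= redot u u /\ complex.Im (u i 0) ^+ 2 <= redot u u.
Proof.
rewrite redot_sqnormE /sqnormE (bigD1 i) //=.
have : 0 <= \sum_(j < d | j != i)
    (complex.Re (u j 0) ^+ 2 + complex.Im (u j 0) ^+ 2).
  by apply: sumr_ge0 => j _; rewrite addr_ge0 ?sqr_ge0.
by move: (sqr_ge0 (complex.Re (u i 0))) (sqr_ge0 (complex.Im (u i 0))); split; lra.
Qed.

(** Degrees strictly below [k]; the projection P_k therefore corresponds to the bound [k.+1]. *)
Definition pip (k : nat) f g : R :=
  \sum_(i < k) \sum_(t : i.-tuple 'I_n) redot (f t) (g t).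

Lemma pipC k f g : pip k f g = pip k g f.
Proof. by apply: eq_bigr => i _; apply: eq_bigr => t _; apply: redotC. Qed.

Lemma pipDl k f g h : pip k (f + g) h = pip k f h + pip k g h.
Proof.
rewrite -big_split; apply: eq_bigr => i _; rewrite -big_split.
by apply: eq_bigr => t _; apply: redotDl.
Qed.

Lemma pipDr k f g h : pip k h (f + g) = pip k h f + pip k h g.
Proof. by rewrite pipC pipDl 2!(pipC k h). Qed.

Lemma pipZl k c f g : pip k (c *: f) g = pip k f (conjc c *: g).
Proof. by apply: eq_bigr => i _; apply: eq_bigr => t _; apply: redotZl. Qed.

Lemma pipZr k (x : R) f g : pip k (x%:C *: f) g = x * pip k f g.
Proof.
rewrite mulr_sumr; apply: eq_bigr => i _; rewrite mulr_sumr.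
by apply: eq_bigr => t _; apply: redotZr.
Qed.

Lemma pip_ge0 k f : 0 <= pip k f f.
Proof. by apply: sumr_ge0 => i _; apply: sumr_ge0 => t _; apply: redot_ge0. Qed.

Lemma pip_nd k l f : (k <= l)%N -> pip k f f <= pip l f f.
Proof.
move=> kl; rewrite -(subnKC kl) /pip big_split_ord /= lerDl.
by apply: sumr_ge0 => i _; apply: sumr_ge0 => t _; apply: redot_ge0.
Qed.

Lemma pip_rec k f g :
  pip k.+1 f g = redot (f [::]) (g [::]) + \sum_x pip k (der x f) (der x g).
Proof.
rewrite /pip big_ord_recl (sum_tuple0 (fun t => redot (f t) (g t))); congr (_ + _).
rewrite exchange_big; apply: eq_bigr => i _.
exact: (sum_tupleS (fun t => redot (f t) (g t))).
Qed.

(* [inFock] phrased with the partial sums of the squared norm. *)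
Definition inF f := exists M, forall k, pip k f f <= M.

Lemma pipND k f g : pip k (f - g) (f - g) = pip k f f - 2 * pip k f g + pip k g g.
Proof.
have -> : f - g = f + (-1)%:C *: g by rewrite rmorphN1 scaleN1r.
by rewrite pipDl pipZr !pipDr !(pipC k _ (_ *: g)) !pipZr (pipC k g f); ring.
Qed.

Lemma pipDD k f g : pip k (f + g) (f + g) = pip k f f + 2 * pip k f g + pip k g g.
Proof. by rewrite pipDl !pipDr (pipC k g f); ring. Qed.

Lemma inF0 : inF (0 : V).
Proof.
exists 0 => k; rewrite /pip big1 // => i _; rewrite big1 // => t _; exact: redot0l.
Qed.

Lemma inFD f g : inF f -> inF g -> inF (f + g).
Proof.
move=> [M HM] [N HN]; exists (2 * M + 2 * N) => k.
have := pip_ge0 k (f - g); rewrite pipND pipDD.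
by move: (HM k) (HN k); lra.
Qed.

Lemma inFZ c f : inF f -> inF (c *: f).
Proof.
move=> [M HM]; exists ((complex.Re c ^+ 2 + complex.Im c ^+ 2) * M) => k.
rewrite pipZl scalerA [pip _ _ _]pipC.
have -> : conjc c * c = (complex.Re c ^+ 2 + complex.Im c ^+ 2)%:C.
  by case: c => a b /=; congr (_ +i* _); ring.
by rewrite pipZr ler_wpM2l // addr_ge0 ?sqr_ge0.
Qed.

Lemma inFN f : inF f -> inF (- f).
Proof. by move=> /(inFZ (-1)); rewrite scaleN1r. Qed.

Lemma inFB f g : inF f -> inF g -> inF (f - g).
Proof. by move=> Hf /inFN; apply: inFD. Qed.

Lemma inF_sum (I : Type) (r : seq I) (P : pred I) (F : I -> V) :
  (forall i, P i -> inF (F i)) -> inF (\sum_(i <- r | P i) F i).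
Proof. by move=> H; apply: big_ind => //; [exact: inF0 | exact: inFD]. Qed.

Lemma inF_der x f : inF f -> inF (der x f).
Proof.
move=> [M HM]; exists M => k; apply: le_trans (HM k.+1).
rewrite pip_rec (bigD1 x) //= addrCA lerDl addr_ge0 ?redot_ge0 //.
by apply: sumr_ge0 => y _; apply: pip_ge0.
Qed.

Lemma inF_rec f : (forall x, inF (der x f)) -> inF f.
Proof.
move=> /choice [M HM]; exists (redot (f [::]) (f [::]) + \sum_x M x) => k.
apply: le_trans (pip_nd f (leqnSn k)) _.
by rewrite pip_rec lerD2l; apply: ler_sum => x _; apply: HM.
Qed.

(** Convergence is guaranteed when both arguments satisfy [inF], whence this hypothesis in most
    lemmas below. *)
Definition rip f g : R := limn (fun k => pip k f g).
Local Notation N2 f := (rip f f).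

Lemma is_cvg_pipN f : inF f -> cvgn (fun k => pip k f f).
Proof.
move=> [M HM]; apply: nondecreasing_is_cvgn; first by move=> k l; apply: pip_nd.
by exists M => _ [k _ <-].
Qed.

(** Polarization reduces this to three bounded monotone sequences of squared norms. *)
Lemma is_cvg_pip f g : inF f -> inF g -> cvgn (fun k => pip k f g).
Proof.
move=> Hf Hg.
have -> : (fun k => pip k f g) = (fun k => 2^-1 * ((fun k => pip k (f + g) (f + g))
    \- (fun k => pip k f f) \- (fun k => pip k g g)) k).
  by apply/funext => k /=; rewrite pipDD; field.
apply: is_cvgMl_tmp; apply: is_cvgB; last exact: is_cvg_pipN.
by apply: is_cvgB; apply: is_cvg_pipN => //; apply: inFD.
Qed.

Lemma cvg_pip f g : inF f -> inF g -> (fun k => pip k f g) @ \oo --> rip f g.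
Proof. by move=> Hf Hg; apply: is_cvg_pip. Qed.

Lemma ripC f g : rip f g = rip g f.
Proof. by congr (limn _); apply/funext => k; apply: pipC. Qed.

Lemma ripDl f g h : inF f -> inF g -> inF h -> rip (f + g) h = rip f h + rip g h.
Proof.
move=> Hf Hg Hh; apply/cvg_lim => //.
under eq_fun do rewrite pipDl.
by apply: cvgD; apply: cvg_pip.
Qed.

Lemma ripDr f g h : inF f -> inF g -> inF h -> rip h (f + g) = rip h f + rip h g.
Proof. by move=> *; rewrite ripC ripDl // 2!(ripC h). Qed.

Lemma ripZl c f g : rip (c *: f) g = rip f (conjc c *: g).
Proof. by congr (limn _); apply/funext => k; apply: pipZl. Qed.

Lemma ripZr (x : R) f g : inF f -> inF g -> rip (x%:C *: f) g = x * rip f g.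
Proof.
move=> Hf Hg; apply/cvg_lim => //.
under eq_fun do rewrite pipZr.
by apply: cvgMl_tmp; apply: cvg_pip.
Qed.

Lemma ripNl f g : inF f -> inF g -> rip (- f) g = - rip f g.
Proof.
move=> Hf Hg; have -> : - f = (-1)%:C *: f by rewrite rmorphN1 scaleN1r.
by rewrite ripZr // mulN1r.
Qed.

Lemma ripNr f g : inF f -> inF g -> rip f (- g) = - rip f g.
Proof. by move=> Hf Hg; rewrite ripC ripNl // ripC. Qed.

Lemma ripBl f g h : inF f -> inF g -> inF h -> rip (f - g) h = rip f h - rip g h.
Proof. by move=> *; rewrite ripDl ?ripNl //; apply: inFN. Qed.

Lemma ripBr f g h : inF f -> inF g -> inF h -> rip h (f - g) = rip h f - rip h g.
Proof. by move=> *; rewrite ripC ripBl // 2!(ripC h). Qed.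

Lemma rip0l f : rip 0 f = 0.
Proof.
rewrite /rip (_ : (fun k => _) = cst 0) ?lim_cst //.
apply/funext => k; rewrite /pip big1 // => i _; rewrite big1 // => t _; exact: redot0l.
Qed.

Lemma rip_sumr (I : Type) (r : seq I) (P : pred I) (F : I -> V) g :
  inF g -> (forall i, P i -> inF (F i)) ->
  rip g (\sum_(i <- r | P i) F i) = \sum_(i <- r | P i) rip g (F i).
Proof.
move=> Hg HF.
suff [] : inF (\sum_(i <- r | P i) F i) /\
    rip g (\sum_(i <- r | P i) F i) = \sum_(i <- r | P i) rip g (F i) by [].
elim/big_ind2 : _ => [|f x h y [Hf <-] [Hh <-]|i Pi].
- by split; [exact: inF0|rewrite ripC rip0l].
- by split; [exact: inFD|rewrite ripDr].
- by split=> //; apply: HF.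
Qed.

Lemma rip_suml (I : Type) (r : seq I) (P : pred I) (F : I -> V) g :
  inF g -> (forall i, P i -> inF (F i)) ->
  rip (\sum_(i <- r | P i) F i) g = \sum_(i <- r | P i) rip (F i) g.
Proof.
by move=> Hg HF; rewrite ripC rip_sumr //; apply: eq_bigr => i _; apply: ripC.
Qed.

Lemma pip_le f k : inF f -> pip k f f <= N2 f.
Proof.
move=> Hf; apply: nondecreasing_cvgn_le; last exact: is_cvg_pipN.
by move=> l m; apply: pip_nd.
Qed.

Lemma N2_le f M : inF f -> (forall k, pip k f f <= M) -> N2 f <= M.
Proof.
by move=> Hf HM; apply: limr_le; [exact: is_cvg_pipN|apply: nearW].
Qed.

Lemma N2_ge0 f : inF f -> 0 <= N2 f.
Proof. by move=> /(pip_le 0); apply: le_trans; apply: pip_ge0. Qed.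

Lemma redot_le_N2 f b : inF f -> redot (f b) (f b) <= N2 f.
Proof.
move=> Hf; apply: le_trans (pip_le (size b).+1 Hf).
rewrite /pip big_ord_recr /= (bigD1 (in_tuple b)) //= addrCA lerDl.
rewrite addr_ge0 //; first exact: pip_ge0.
by apply: sumr_ge0 => t _; apply: redot_ge0.
Qed.

Lemma rip_rec f g : inF f -> inF g ->
  rip f g = redot (f [::]) (g [::]) + \sum_x rip (der x f) (der x g).
Proof.
move=> Hf Hg; apply/cvg_lim => //; rewrite -cvg_shiftS.
under eq_fun do rewrite /= pip_rec.
apply: cvgD; first exact: cvg_cst.
apply: cvg_big => [|x _]; first exact: add_continuous.
by apply: cvg_pip; apply: inF_der.
Qed.

Lemma N2D f g : inF f -> inF g -> N2 (f + g) = N2 f + 2 * rip f g + N2 g.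
Proof.
by move=> Hf Hg; rewrite !(ripDl,ripDr) //; try exact: inFD; rewrite (ripC g f); ring.
Qed.

Lemma N2N f : inF f -> N2 (- f) = N2 f.
Proof. by move=> Hf; rewrite ripNl ?ripNr ?opprK //; apply: inFN. Qed.

Lemma N2B f g : inF f -> inF g -> N2 (f - g) = N2 f - 2 * rip f g + N2 g.
Proof.
by move=> Hf Hg; rewrite N2D ?N2N ?ripNr //; [ring|exact: inFN].
Qed.

Lemma N2D_le f g : inF f -> inF g -> N2 (f + g) <= 2 * N2 f + 2 * N2 g.
Proof.
by move=> Hf Hg; have := N2_ge0 (inFB Hf Hg); rewrite N2B // N2D //; lra.
Qed.

Lemma rip_le_half f g : inF f -> inF g -> rip f g <= 2^-1 * (N2 f + N2 g).
Proof.
by move=> Hf Hg; have := N2_ge0 (inFB Hf Hg); rewrite (N2B Hf Hg); lra.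
Qed.

Lemma N2Z c f : inF f -> N2 (c *: f) = (complex.Re c ^+ 2 + complex.Im c ^+ 2) * N2 f.
Proof.
move=> Hf; rewrite ripZl scalerA ripC.
have -> : conjc c * c = (complex.Re c ^+ 2 + complex.Im c ^+ 2)%:C.
  by case: c => a b /=; congr (_ +i* _); ring.
by rewrite ripZr.
Qed.

Lemma rip_sqr_le f g : inF f -> inF g -> rip f g ^+ 2 <= N2 f * N2 g.
Proof.
move=> Hf Hg; apply: sqr_le_of_quadratic_ge0 => [|t]; first exact: N2_ge0.
have Hg' := inFZ t%:C Hg.
have := N2_ge0 (inFD Hf Hg'); rewrite N2D // N2Z // (ripC f) ripZr // (ripC g) /=.
by rewrite expr0n addr0 mulrA.
Qed.

End FockSpace.

(* Otherwise failing conversion checks unfold limits, and do not terminate in practice. *)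
#[global] Opaque rip.

(** * Completeness and the complex inner product *)

Section FockComplete.
Variables (R : realType) (n d : nat).
Local Notation C := R[i].
Local Notation V := (seq 'I_n -> 'cV[C]_d).
Implicit Types (f g h : V) (c : C) (u v : 'cV[C]_d).
Local Notation N2 f := (rip f f).

Lemma sqnorm_limE f : sqnorm f = limn (EFin \o (fun k => pip k f f)).
Proof.
congr (limn _); apply/funext => k /=; rewrite /pip big_mkord -sumEFin.
by apply: eq_bigr => i _; congr (_%:E); apply: eq_bigr => t _.
Qed.

Lemma sqnorm_rip f : inF f -> sqnorm f = (N2 f)%:E.
Proof. by move=> Hf; rewrite sqnorm_limE EFin_lim //; apply: is_cvg_pipN. Qed.

Lemma inFockP f : inFock f <-> inF f.
Proof.
split=> [Hf|Hf]; last by rewrite /inFock sqnorm_rip // ltry.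
have pos m : true -> (0%R <= (\sum_(t : m.-tuple 'I_n) sqnormE (f (val t)))%:E)%E.
  move=> _; rewrite lee_fin; apply: sumr_ge0 => t _.
  by rewrite -redot_sqnormE redot_ge0.
have pk k : ((pip k f f)%:E <= sqnorm f)%E.
  apply: le_trans (nneseries_lim_ge k (fun m _ => pos m)).
  rewrite big_mkord sumEFin lee_fin; apply: ler_sum => i _; apply: ler_sum => t _.
  by rewrite redot_sqnormE.
exists (fine (sqnorm f)) => k; rewrite -lee_fin fineK //.
by rewrite ge0_fin_numE //; apply: le_trans (pk 0%N); rewrite lee_fin pip_ge0.
Qed.

(** Completeness with a rate. Each coordinate is Cauchy, and for fixed [k] the finite sum [pip k]
    passes to the limit with the bound [e m], which is uniform in [k]. *)
Lemma inF_limit (F : nat -> V) (e : nat -> R) : (forall m, inF (F m)) ->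
  (forall m l, (m <= l)%N -> N2 (F l - F m) <= e m) -> e @ \oo --> 0 ->
  exists2 f, inF f & forall m, N2 (f - F m) <= e m.
Proof.
move=> HF He e0.
have cau (x : nat -> R) : (forall m l, (m <= l)%N -> (x l - x m) ^+ 2 <= e m) ->
    cvgn x.
  move=> Hx; apply: cauchy_cvg; apply: cauchy_exP => eps eps0.
  have /cvgrPdist_lt/(_ _ (exprn_gt0 2 eps0)) [m _ Hm] := e0.
  exists (x m); exists m => // l /= ml; rewrite /ball /= distrC.
  rewrite ltNge; apply/negP => Hge.
  have := lerXn2r 2 (ltW eps0) (normr_ge0 _) Hge; rewrite real_normK ?num_real //.
  apply/negP; rewrite -ltNge.
  apply: le_lt_trans (Hx _ _ ml) _; have := Hm m (leqnn m).
  by rewrite /= sub0r normrN; apply: le_lt_trans; apply: ler_norm.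
have coord m l b i : (m <= l)%N ->
    (complex.Re (F l b i 0) - complex.Re (F m b i 0)) ^+ 2 <= e m /\
    (complex.Im (F l b i 0) - complex.Im (F m b i 0)) ^+ 2 <= e m.
  move=> ml; have [H1 H2] := redot_coord ((F l - F m) b) i.
  have H := le_trans (redot_le_N2 b (inFB (HF l) (HF m))) (He _ _ ml).
  move: H1 H2; rewrite !mxE.
  by case: (F l b i 0) (F m b i 0) => a a' [b' b''] /= H1 H2; split; apply: le_trans H.
have cR b i : cvgn (fun l => complex.Re (F l b i 0)).
  by apply: cau => m l ml; have [] := coord m l b i ml.
have cI b i : cvgn (fun l => complex.Im (F l b i 0)).
  by apply: cau => m l ml; have [] := coord m l b i ml.
pose f : V := fun b => \col_i (limn (fun l => complex.Re (F l b i 0))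
                            +i* limn (fun l => complex.Im (F l b i 0))).
have pipf m k : pip k (f - F m) (f - F m) <= e m.
  have cv : (fun l => pip k (F l - F m) (F l - F m)) @ \oo
      --> pip k (f - F m) (f - F m).
    apply: cvg_big => [|i _]; first exact: add_continuous.
    apply: cvg_big => [|t _]; first exact: add_continuous.
    apply: cvg_big => [|j _]; first exact: add_continuous.
    have h1 : (fun l => complex.Re ((F l - F m) t j 0)) @ \oo
        --> complex.Re ((f - F m) t j 0).
      have -> : (fun l => complex.Re ((F l - F m) t j 0)) =
          (fun l => complex.Re (F l t j 0) - complex.Re (F m t j 0)).
        apply/funext => l; rewrite !mxE.
        by case: (F l t j 0) (F m t j 0) => ? ? [].
      have -> : complex.Re ((f - F m) t j 0) =
          limn (fun l => complex.Re (F l t j 0)) - complex.Re (F m t j 0).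
        by rewrite !mxE; case: (F m t j 0).
      by apply: cvgB; [exact: cR|exact: cvg_cst].
    have h2 : (fun l => complex.Im ((F l - F m) t j 0)) @ \oo
        --> complex.Im ((f - F m) t j 0).
      have -> : (fun l => complex.Im ((F l - F m) t j 0)) =
          (fun l => complex.Im (F l t j 0) - complex.Im (F m t j 0)).
        apply/funext => l; rewrite !mxE.
        by case: (F l t j 0) (F m t j 0) => ? ? [].
      have -> : complex.Im ((f - F m) t j 0) =
          limn (fun l => complex.Im (F l t j 0)) - complex.Im (F m t j 0).
        by rewrite !mxE; case: (F m t j 0).
      by apply: cvgB; [exact: cI|exact: cvg_cst].
    by apply: cvgD; apply: cvgM.
  apply: (cvgr_to_le cv); exists m => // l /= ml.
  by apply: le_trans (He _ _ ml); apply: pip_le; apply: inFB.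
have Hf m : inF (f - F m) by exists (e m).
exists f => [|m]; last exact: N2_le.
by rewrite -(subrK (F 0%N) f); apply: inFD.
Qed.

Lemma sum_expi4 (F : C -> R) :
  \sum_(k < 4) ('i%R : C) ^+ k * (F ('i%R ^+ k))%:C =
  (F 1 - F (-1)) +i* (F 'i%C - F (- 'i%C)).
Proof.
have i2 : ('i%R : C) ^+ 2 = -1 by exact: sqrCi.
have i3 : ('i%R : C) ^+ 3 = - 'i%R by rewrite exprS i2 mulrN1.
rewrite !big_ord_recr big_ord0 /= expr0 expr1 i2 i3 -complexiE.
by apply/eqP; rewrite eq_complex /=; apply/andP; split; apply/eqP; ring.
Qed.

Lemma rip_il f g : inF f -> inF g -> rip ('i%C *: f) g = - rip f ('i%C *: g).
Proof.
move=> Hf Hg; have Hi := inFZ 'i%C Hg.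
have -> : rip ('i%C *: f) g = rip f ((- 'i%C) *: g).
  by rewrite ripZl (_ : conjc _ = - 'i%C) //; apply/eqP; rewrite eq_complex /= oppr0 !eqxx.
by rewrite scaleNr ripNr.
Qed.

Lemma rip_scaler f g c : inF f -> inF g ->
  rip f (c *: g) = complex.Re c * rip f g + complex.Im c * rip f ('i%C *: g).
Proof.
move=> Hf Hg; have Hi := inFZ 'i%C Hg.
have -> : c *: g = (complex.Re c)%:C *: g + (complex.Im c)%:C *: ('i%C *: g).
  rewrite scalerA -scalerDl.
  by have {1}-> : c = (complex.Re c)%:C + (complex.Im c)%:C * 'i%C
    by rewrite [LHS]complexE mulrC.
rewrite ripC (ripDl (inFZ _ Hg) (inFZ _ Hi) Hf).
by rewrite (ripZr _ Hg Hf) (ripZr _ Hi Hf) (ripC g) (ripC _ f).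
Qed.

(** For a form linear on the left, Im <f, g> = Re <f, i g>. *)
Lemma ipE f g : inF f -> inF g -> ip f g = rip f g +i* rip f ('i%C *: g).
Proof.
move=> Hf Hg; rewrite /ip.
have N2c c : fine (sqnorm (fadd f (fscale c g))) =
    N2 f + 2 * (complex.Re c * rip f g + complex.Im c * rip f ('i%C *: g))
    + (complex.Re c ^+ 2 + complex.Im c ^+ 2) * N2 g.
  have Hcg := inFZ c Hg.
  rewrite -[fadd _ _]/(f + c *: g).
  rewrite (sqnorm_rip (inFD Hf Hcg)).
  rewrite (N2D Hf Hcg).
  rewrite (N2Z _ Hg).
  rewrite (rip_scaler _ Hf Hg).
  by [].
under eq_bigr => k _ do rewrite N2c.
move: (N2 f) (N2 g) (rip f g) (rip f ('i%C *: g)) => a b e e'.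
have E4 := sum_expi4 (fun c => a + 2 * (complex.Re c * e + complex.Im c * e') +
  (complex.Re c ^+ 2 + complex.Im c ^+ 2) * b).
transitivity ((4^-1 : R)%:C * ((4 * e) +i* (4 * e'))); last first.
  by apply/eqP; rewrite eq_complex /=; apply/andP; split; apply/eqP; field.
congr (_ * _); first by rewrite fmorphV rmorph_nat.
apply: etrans E4 _.
by apply/eqP; rewrite eq_complex /=; apply/andP; split; apply/eqP; ring.
Qed.

Lemma Re_ipZ f g c c' : inF f -> inF g ->
  complex.Re (conjc c' * ip f g * c) = rip (c *: f) (c' *: g).
Proof.
move=> Hf Hg; rewrite ipE // ripZl scalerA (rip_scaler (conjc c * c') Hf Hg).
move: (rip f g) (rip f ('i%C *: g)) => r r'.
by case: c c' => a b [a' b'] /=; ring.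
Qed.

Lemma ip_conj f g : inF f -> inF g -> ip g f = conjc (ip f g).
Proof.
move=> Hf Hg; rewrite !ipE //= ripC; congr (_ +i* _).
by rewrite ripC rip_il.
Qed.

End FockComplete.

(** * Formal multi-analytic operators as convolutions *)

Section Convolution.
Variables (K : comUnitRingType) (T : Type).

(* [convol A p w] is the sum of [A v *m p u] over the factorizations [w = u ++ v];
   hence [convol theta p] is the paper's M_theta p, for formal series p as well. *)
Fixpoint convol a b c (A : seq T -> 'M[K]_(a, b)) (p : seq T -> 'M[K]_(b, c))
    (w : seq T) : 'M[K]_(a, c) :=
  if w is x :: v then A w *m p [::] + convol A (der x p) v else A [::] *m p [::].

Variables a b c : nat.
Implicit Types (A : seq T -> 'M[K]_(a, b)) (p q : seq T -> 'M[K]_(b, c)).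

(** Causality: a prefix of [w] is no longer than [w], so high coefficients of [p] cannot affect low
    ones of the product. *)
Lemma convol_eq A p q w : (forall v, (size v <= size w)%N -> p v = q v) ->
  convol A p w = convol A q w.
Proof.
elim: w p q => [|x w IHw] p q H /=; first by rewrite H.
by rewrite H // (IHw _ (der x q)) // => v sv; apply: H.
Qed.

Lemma convolD A p q : convol A (p + q) = convol A p + convol A q.
Proof.
apply/funext => w; rewrite fctE; elim: w p q => [|x w IHw] p q /=.
  by rewrite fctE mulmxDr.
by rewrite -[der x _]/(der x p + der x q) IHw !fctE mulmxDr addrACA.
Qed.

Lemma convolZ A (k : K) p : convol A (k *: p) = k *: convol A p.
Proof.
apply/funext => w; rewrite fctE; elim: w p => [|x w IHw] p /=.
  by rewrite fctE -scalemxAr.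
by rewrite -[der x _]/(k *: der x p) IHw !fctE scalerDr -scalemxAr.
Qed.

Lemma convolB A p q : convol A (p - q) = convol A p - convol A q.
Proof. by rewrite -scaleN1r convolD convolZ scaleN1r. Qed.

Lemma convol0r A : convol A (0 : seq T -> 'M[K]_(b, c)) = 0.
Proof. by rewrite -(scale0r 0) convolZ !scale0r. Qed.

(** A Leibniz rule. When [p [::] = 0] it says that [der x] commutes with the product, which drives
    the inductions on degree. *)
Lemma der_convol A p x :
  der x (convol A p) = (fun w => der x A w *m p [::]) + convol A (der x p).
Proof. by []. Qed.

Lemma der_convol0 A p x : p [::] = 0 -> der x (convol A p) = convol A (der x p).
Proof.
move=> p0; rewrite der_convol; apply/funext => w.
by rewrite fctE p0 mulmx0 add0r.
Qed.

Definition delta_nil (h : 'M[K]_(b, c)) : seq T -> 'M[K]_(b, c) :=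
  fun w => if w is [::] then h else 0.

Lemma der_delta_nil x h : der x (delta_nil h) = 0. Proof. by []. Qed.

Lemma convol_delta_nil A h : convol A (delta_nil h) = fun w => A w *m h.
Proof.
by apply/funext => -[|x w] //=; rewrite der_delta_nil convol0r addr0.
Qed.

Definition chop p : seq T -> 'M[K]_(b, c) := fun w => if w is [::] then 0 else p w.

Lemma delta_nil_chop p : p = delta_nil (p [::]) + chop p.
Proof. by apply/funext => -[|x w]; rewrite fctE /= ?addr0 ?add0r. Qed.

Lemma convol_chop A p : convol A p = (fun w => A w *m p [::]) + convol A (chop p).
Proof. by rewrite {1}[p]delta_nil_chop convolD convol_delta_nil. Qed.

Definition trunc k p : seq T -> 'M[K]_(b, c) :=
  fun w => if (size w < k)%N then p w else 0.

Definition supp_lt k p := forall w, (k <= size w)%N -> p w = 0.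
Definition vanish_lt k p := forall w, (size w < k)%N -> p w = 0.

Lemma supp_lt_trunc k p : supp_lt k (trunc k p).
Proof. by move=> w kw; rewrite /trunc ltnNge kw. Qed.

Lemma trunc0 p : trunc 0 p = 0. Proof. by []. Qed.

Lemma trunc_id k p : supp_lt k p -> trunc k p = p.
Proof.
by move=> H; apply/funext => w; rewrite /trunc; case: ltnP => // /H.
Qed.

Lemma supp_lt_der k p x : supp_lt k.+1 p -> supp_lt k (der x p).
Proof. by move=> H w kw; apply: H. Qed.

Lemma vanish_lt_der k p x : vanish_lt k.+1 p -> vanish_lt k (der x p).
Proof. by move=> H w kw; apply: H. Qed.

Lemma supp_lt0 p : supp_lt 0 p -> p = 0.
Proof. by move=> H; apply/funext => w; apply: H. Qed.

Lemma supp_lt_leq k l p : (k <= l)%N -> supp_lt k p -> supp_lt l p.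
Proof. by move=> kl H w lw; apply: H; apply: leq_trans lw. Qed.

Lemma supp_ltD k p q : supp_lt k p -> supp_lt k q -> supp_lt k (p + q).
Proof. by move=> Hp Hq w kw; rewrite fctE Hp // Hq // addr0. Qed.

Lemma supp_ltZ k (z : K) p : supp_lt k p -> supp_lt k (z *: p).
Proof. by move=> Hp w kw; rewrite fctE Hp // scaler0. Qed.

Lemma vanish_ltD k p q : vanish_lt k p -> vanish_lt k q -> vanish_lt k (p + q).
Proof. by move=> Hp Hq w kw; rewrite fctE Hp // Hq // addr0. Qed.

Lemma vanish_ltZ k (z : K) p : vanish_lt k p -> vanish_lt k (z *: p).
Proof. by move=> Hp w kw; rewrite fctE Hp // scaler0. Qed.

Lemma subr_vanish k p q w : vanish_lt k q -> (size w < k)%N -> (p - q) w = p w.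
Proof. by move=> vq wk; rewrite !fctE vq // subr0. Qed.

Lemma convol_vanish k A q : vanish_lt k q ->
  forall w, (size w < k)%N -> convol A q w = 0.
Proof.
move=> vq w wk; rewrite (@convol_eq A q 0 w); first by rewrite convol0r.
by move=> v vw; apply: vq; apply: leq_ltn_trans wk.
Qed.

Lemma supp_lt_delta_nil h : supp_lt 1 (delta_nil h).
Proof. by case. Qed.

Lemma supp_lt_chop k p : supp_lt k p -> supp_lt k (chop p).
Proof. by move=> H [|x w] kw //=; apply: H. Qed.

Lemma der_trunc k p x : der x (trunc k.+1 p) = trunc k (der x p).
Proof. by apply/funext => w. Qed.

End Convolution.

Lemma convolA (K : comUnitRingType) (T : Type) a b c e (A : seq T -> 'M[K]_(a, b))
    (B : seq T -> 'M[K]_(b, c)) (p : seq T -> 'M[K]_(c, e)) :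
  convol A (convol B p) = convol (convol A B) p.
Proof.
apply/funext => w; elim: w a b A B p => [|x w IHw] a b A B p /=.
  by rewrite mulmxA.
rewrite der_convol convolD fctE addrA -IHw; congr (_ + _).
rewrite mulmxA mulmxDl; congr (_ + _).
(* What remains is that right multiplication by a constant matrix commutes with [convol A]. *)
move: (der x B) (p [::]) => {IHw p}B h.
elim: w B => [|y w IHw] B /=; first by rewrite mulmxA.
by rewrite mulmxDl mulmxA -IHw.
Qed.

Section ConvolInverse.
Variables (K : comUnitRingType) (T : Type) (m : nat) (A : seq T -> 'M[K]_m).

(* Formal division: [convol A q = B] determines [q [::]] from the empty word, and
   comparing the words [x :: u] leaves the same equation for [der x q]. *)
Fixpoint convol_div (w : seq T) (B : seq T -> 'M[K]_m) : 'M[K]_m :=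
  let q0 := invmx (A [::]) *m B [::] in
  if w is x :: v then convol_div v (fun u => B (x :: u) - A (x :: u) *m q0) else q0.

Lemma convol_divK (B : seq T -> 'M[K]_m) : A [::] \in unitmx ->
  convol A (fun w => convol_div w B) = B.
Proof.
move=> uA; apply/funext => w.
elim: w B => [|x w IHw] B /=; first by rewrite mulKVmx.
by rewrite [convol _ _ _]IHw addrC subrK.
Qed.

End ConvolInverse.

(** * The operator [Mop] as a convolution *)

Section FockConvol.
Variables (R : realType) (n d : nat).
Local Notation C := R[i].
Local Notation V := (seq 'I_n -> 'cV[C]_d).
Implicit Types (f g h p q : V) (c : C) (u v : 'cV[C]_d) (A B : opE R n d).
Local Notation N2 f := (rip f f).

Lemma PkE k f : Pk k f = trunc k.+1 f. Proof. by []. Qed.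

(** Links the recursion on words to the sum of shifts defining [Mop]: at a word starting with [x],
    besides the empty index only indices starting with [x] contribute. *)
Lemma convol_trunc A m p w : convol A (trunc m p) w =
  \sum_(i < m) \sum_(t : i.-tuple 'I_n) shiftw t (app A (p t)) w.
Proof.
elim: w A m p => [|x w IHw] A [|m] p.
- by rewrite big_ord0 trunc0 convol0r.
- rewrite big_ord_recl (sum_tuple0 (fun t => shiftw t (app A (p t)) [::])) /=.
  rewrite big1 ?addr0 // => i _.
  rewrite (sum_tupleS (fun t => shiftw t (app A (p t)) [::])).
  by rewrite big1 // => x _; rewrite big1.
- by rewrite big_ord0 trunc0 convol0r.
rewrite big_ord_recl (sum_tuple0 (fun t => shiftw t (app A (p t)) _)) /=.
rewrite der_trunc IHw; congr (_ + _); apply: eq_bigr => i _.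
rewrite (sum_tupleS (fun t => shiftw t (app A (p t)) _)) (bigD1 x) //=.
rewrite [X in _ + X]big1 ?addr0 => [|y /negPf yx]; last first.
  by rewrite big1 // => t _; rewrite /shiftw /= yx.
by apply: eq_bigr => t _; rewrite /shiftw /= eqxx.
Qed.

Lemma MopE A m p : Mop A m p = convol A (trunc m.+1 p).
Proof. by apply/funext => w; rewrite convol_trunc. Qed.

Lemma Mop_sum A m p :
  Mop A m p = \sum_(i < m.+1) \sum_(t : i.-tuple 'I_n) shiftw t (app A (p t)).
Proof.
apply/funext => w; rewrite fct_sumE; apply: eq_bigr => i _.
by rewrite fct_sumE.
Qed.

Lemma der_shiftw x y a f :
  der y (shiftw (x :: a) f) = if x == y then shiftw a f else 0.
Proof. by apply/funext => b; rewrite /der /shiftw /=; case: eqP. Qed.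

Lemma inF_shiftw a f : inF f -> inF (shiftw a f).
Proof.
move=> Hf; elim: a => [|x a IHa]; last first.
  apply: inF_rec => y; rewrite der_shiftw; case: eqP => // _; exact: inF0.
suff -> : shiftw [::] f = f by [].
by apply/funext => b; rewrite /shiftw prefix0s drop0.
Qed.

Lemma convol_shiftw A a p : convol A (shiftw a p) = shiftw a (convol A p).
Proof.
apply/funext => w; elim: w a p => [|x w IHw] [|y a] p.
- by rewrite /= /shiftw.
- by rewrite /= /shiftw /= mulmx0.
- congr (convol A _ _); apply/funext => b; by rewrite /shiftw prefix0s drop0.
rewrite /= der_shiftw {1}/shiftw /= mulmx0 add0r /shiftw /= -/(shiftw _ _).
by case: eqP => _ /=; [rewrite IHw|rewrite convol0r].
Qed.

Lemma appE A u : app A u = convol A (delta_nil u).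
Proof. by rewrite convol_delta_nil. Qed.

Lemma appDr A u v : app A (u + v) = app A u + app A v.
Proof. by apply/funext => w; rewrite /app fctE mulmxDr. Qed.

Lemma appZr A c u : app A (c *: u) = c *: app A u.
Proof. by apply/funext => w; rewrite /app fctE scalemxAr. Qed.

Lemma app_basis A u : app A u = \sum_(l < d) u l 0 *: app A (Defs.basis R l).
Proof.
apply/funext => w; rewrite fct_sumE /app {1}[u]matrix_sum_delta mulmx_sumr.
by apply: eq_bigr => l _; rewrite big_ord1 fctE scalemxAr.
Qed.

Definition bdd A := forall u, inF (app A u).

Lemma bddP A : bounded_op A <-> bdd A.
Proof. by split=> H u; apply/inFockP. Qed.

Lemma inF_convol A m p : bdd A -> supp_lt m p -> inF (convol A p).
Proof.
move=> HA; elim: m p => [|m IHm] p Hp.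
  by rewrite (supp_lt0 Hp) convol0r; apply: inF0.
apply: inF_rec => x; rewrite der_convol; apply: inFD; first exact: (inF_der x (HA _)).
exact/IHm/supp_lt_der.
Qed.

End FockConvol.

(** * Closures of the ranges of M_theta *)

Section Closure.
Variables (R : realType) (n d : nat) (theta : opE R n d).
Local Notation C := R[i].
Local Notation V := (seq 'I_n -> 'cV[C]_d).
Implicit Types (f g p q : V) (c : C) (h u v : 'cV[C]_d).
Local Notation N2 f := (rip f f).
Hypothesis bdd_theta : bdd theta.
Let inF_theta := fun m p (Hp : supp_lt m p) => inF_convol bdd_theta Hp.

(* The closure of the image under M_theta of the polynomials of order at least [k]. *)
Definition clos k f := inF f /\ forall eps : R, 0 < eps ->
  exists m q, [/\ supp_lt m q, vanish_lt k q & N2 (f - convol theta q) < eps].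

Lemma clos_convol k m q : supp_lt m q -> vanish_lt k q -> clos k (convol theta q).
Proof.
move=> Hm Hk; split=> [|eps e0]; first exact: inF_theta Hm.
by exists m, q; split=> //; rewrite subrr rip0l.
Qed.

Lemma clos0 k : clos k 0.
Proof. by rewrite -(convol0r 1 theta); apply: (@clos_convol _ 0). Qed.

Lemma closD k f g : clos k f -> clos k g -> clos k (f + g).
Proof.
move=> [If Hf] [Ig Hg]; split=> [|eps e0]; first exact: inFD.
(* [N2D_le] costs a factor 2 on each of the two errors. *)
have e4 : 0 < eps / 4 by rewrite divr_gt0.
have [m [q [sq vq Nq]]] := Hf _ e4; have [l [r [sr vr Nr]]] := Hg _ e4.
have sq' := supp_lt_leq (leq_maxl m l) sq; have sr' := supp_lt_leq (leq_maxr m l) sr.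
exists (maxn m l), (q + r); split; [exact: supp_ltD|exact: vanish_ltD|].
rewrite convolD; have -> : f + g - (convol theta q + convol theta r) =
  (f - convol theta q) + (g - convol theta r) by rewrite opprD addrACA.
apply: le_lt_trans (N2D_le (inFB If (inF_theta sq)) (inFB Ig (inF_theta sr))) _.
lra.
Qed.

Lemma closZ k c f : clos k f -> clos k (c *: f).
Proof.
move=> [If Hf]; split=> [|eps e0]; first exact: inFZ.
set M := complex.Re c ^+ 2 + complex.Im c ^+ 2.
have M0 : 0 <= M by rewrite addr_ge0 ?sqr_ge0.
have M1 : 0 < M + 1 by rewrite ltr_wpDl.
have [m [q [sq vq Nq]]] := Hf _ (divr_gt0 e0 M1).
exists m, (c *: q); split; [exact: supp_ltZ|exact: vanish_ltZ|].
have If' := inFB If (inF_theta sq).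
rewrite convolZ -scalerBr (N2Z _ If') -/M.
apply: le_lt_trans (_ : (M + 1) * N2 (f - convol theta q) < _).
  by rewrite ler_wpM2r ?N2_ge0 // lerDl.
by rewrite mulrC -ltr_pdivlMr.
Qed.

Lemma closN k f : clos k f -> clos k (- f).
Proof. by rewrite -scaleN1r; apply: closZ. Qed.

Lemma closB k f g : clos k f -> clos k g -> clos k (f - g).
Proof. by move=> Hf /closN; apply: closD. Qed.

Lemma clos_sum k (I : Type) (r : seq I) (P : pred I) (F : I -> V) :
  (forall i, P i -> clos k (F i)) -> clos k (\sum_(i <- r | P i) F i).
Proof. by move=> H; apply: big_ind => //; [exact: clos0|exact: closD]. Qed.

Lemma clos_leq k l f : (l <= k)%N -> clos k f -> clos l f.
Proof.
move=> lk [If Hf]; split=> // eps /Hf [m [q [sq vq Nq]]].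
by exists m, q; split=> // w wl; apply: vq; apply: leq_trans lk.
Qed.

Lemma clos_limit k f : inF f ->
  (forall eps : R, 0 < eps -> exists2 g, clos k g & N2 (f - g) < eps) -> clos k f.
Proof.
move=> If H; split=> // eps e0.
have e4 : 0 < eps / 4 by rewrite divr_gt0.
have [g [Ig Hg] Nfg] := H _ e4; have [m [q [sq vq Nq]]] := Hg _ e4.
exists m, q; split=> //; rewrite -(subrKA g).
apply: le_lt_trans (N2D_le (inFB If Ig) (inFB Ig (inF_theta sq))) _.
lra.
Qed.

Lemma subr_convol_nil f q :
  (f - convol theta q) [::] = f [::] - at0 theta *m q [::].
Proof. by []. Qed.

Lemma N2_der_le x f : inF f -> N2 (der x f) <= N2 f.
Proof.
move=> If; rewrite [leRHS](rip_rec If If) (bigD1 x) //= addrCA lerDl addr_ge0 ?redot_ge0 //.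
by apply: sumr_ge0 => y _; apply: N2_ge0; apply: inF_der.
Qed.

Lemma clos_nil f : clos 1 f -> f [::] = 0.
Proof.
move=> [If Hf]; apply: redot_eq0; apply/ler_addgt0Pr => eps e0; rewrite add0r.
have [m [q [sq vq /ltW]]] := Hf _ e0; apply: le_trans.
have := redot_le_N2 [::] (inFB If (inF_theta sq)).
by rewrite subr_convol_nil vq // mulmx0 subr0.
Qed.

(** Approximants of order at least 1 have no constant term, so M_theta commutes with [der x] on
    them, and [der x] is a contraction. *)
Lemma clos_der k x f : clos k.+1 f -> clos k (der x f).
Proof.
move=> [If Hf]; split=> [|eps /Hf [m [q [sq vq Nq]]]]; first exact: inF_der.
exists m, (der x q); split; [|exact: vanish_lt_der|].
  by apply: supp_lt_der; apply: supp_lt_leq sq.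
have Iq := inF_theta sq; rewrite -der_convol0 ?vq //.
exact: le_lt_trans (N2_der_le x (inFB If Iq)) Nq.
Qed.

(** Approximants for the separate letters are glued into one polynomial; the squared errors add up
    because different letters give orthogonal pieces. *)
Lemma clos_cons k f : f [::] = 0 -> (forall x, clos k (der x f)) -> clos k.+1 f.
Proof.
move=> f0 Hf; have If : inF f by apply: inF_rec => x; case: (Hf x).
(* Dividing by [n.+1] keeps the sum of [n] errors strictly below [eps], also for [n = 0]. *)
split=> // eps e0; have e1 : 0 < eps / n.+1%:R by rewrite divr_gt0.
have /choice [m /choice [q Hq]] : forall x, exists m q,
    [/\ supp_lt m q, vanish_lt k q & N2 (der x f - convol theta q) < eps / n.+1%:R].
  by move=> x; have [_] := Hf x; apply.
pose r : V := fun w => if w is x :: v then q x v else 0.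
have sr : supp_lt (\max_x m x).+1 r.
  move=> [|x w] // mw; have [sq _ _] := Hq x; apply: sq.
  exact: leq_trans (leq_bigmax (F := m) x) (mw : (\max_y m y <= size w)%N).
exists (\max_x m x).+1, r; split=> //.
  by move=> [|x w] //= wk; have [_ vq _] := Hq x; apply: vq.
have Ir := inFB If (inF_theta sr).
rewrite (rip_rec Ir Ir) subr_convol_nil f0 mulmx0 subr0 redot0l add0r.
apply: le_lt_trans (_ : \sum_(x < n) eps / n.+1%:R < _).
  apply: ler_sum => x _.
  have -> : der x (f - convol theta r) = der x f - convol theta (q x).
    by rewrite -[LHS]/(der x f - der x (convol theta r)) der_convol0.
  by have [_ _ /ltW] := Hq x.
rewrite sumr_const card_ord -[X in X < _]mulr_natr mulrAC ltr_pdivrMr //.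
by rewrite ltr_pM2l // ltr_nat.
Qed.

Lemma eq0_of_sqr_le (x a : R) : (forall eps, 0 < eps -> x ^+ 2 <= a * eps) -> x = 0.
Proof.
move=> H; apply/eqP; rewrite -sqrf_eq0 eq_le sqr_ge0 andbT.
have a0 : 0 <= a by have := le_trans (sqr_ge0 x) (H 1 ltr01); rewrite mulr1.
apply/ler_addgt0Pr => eps e0; rewrite add0r.
apply: le_trans (H (eps / (a + 1)) _) _; first by rewrite divr_gt0 // ltr_wpDl.
by rewrite mulrA ler_pdivrMr ?ltr_wpDl // mulrC ler_pM2l // lerDl.
Qed.

Lemma rip_clos_eq0 k f g : inF f ->
  (forall m q, supp_lt m q -> vanish_lt k q -> rip f (convol theta q) = 0) ->
  clos k g -> rip f g = 0.
Proof.
move=> If Hf [Ig Hg]; apply: (@eq0_of_sqr_le _ (N2 f)) => eps e0.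
have [m [q [sq vq /ltW Nq]]] := Hg _ e0; have Iq := inF_theta sq.
have -> : rip f g = rip f (g - convol theta q).
  by rewrite (ripBr Ig Iq If) (Hf _ _ sq vq) subr0.
apply: le_trans (rip_sqr_le If (inFB Ig Iq)) _.
by rewrite ler_wpM2l // N2_ge0.
Qed.

(** Finite dimension makes pointwise square summability uniform. Expanding in the basis and bounding
    each cross term by half the sum of two squared norms produces the factor [d]. *)
Lemma bdd_bound (A : opE R n d) : bdd A ->
  exists2 M, 0 <= M & forall v, N2 (app A v) <= M * redot v v.
Proof.
move=> bA; pose g l := app A (Defs.basis R l).
exists (d%:R * \sum_(l < d) N2 (g l)).
  by rewrite mulr_ge0 // sumr_ge0 // => l _; apply: N2_ge0; apply: bA.
move=> v; rewrite app_basis.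
have Ig l : inF (v l 0 *: g l) by apply/inFZ/bA.
have Is : inF (\sum_(l < d) v l 0 *: g l) by apply: inF_sum => l _; apply: Ig.
rewrite (rip_suml _ Is (fun l (_ : xpredT l) => Ig l)).
under eq_bigr => l _ do rewrite (rip_sumr _ (Ig l) (fun j (_ : xpredT j) => Ig j)).
apply: le_trans (_ : \sum_(l < d) \sum_(j < d)
    2^-1 * (N2 (v l 0 *: g l) + N2 (v j 0 *: g j)) <= _).
  apply: ler_sum => l _; apply: ler_sum => j _.
  exact: rip_le_half.
have -> (a : 'I_d -> R) : \sum_(l < d) \sum_(j < d) 2^-1 * (a l + a j) =
    d%:R * \sum_(l < d) a l.
  under eq_bigr => l _ do rewrite -mulr_sumr big_split /= sumr_const card_ord.
  rewrite -mulr_sumr big_split /= sumr_const card_ord sumrMnl -mulr_natl.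
  by move: (\sum_(i < d) a i) => b; field.
rewrite -mulrA ler_wpM2l // mulr_suml; apply: ler_sum => l _.
rewrite (N2Z _ (bA _)) mulrC ler_wpM2l ?N2_ge0 //.
rewrite redot_sqnormE /sqnormE (bigD1 l) //= lerDl sumr_ge0 // => j _.
by rewrite addr_ge0 ?sqr_ge0.
Qed.

(* The constant term of an approximating polynomial is controlled by its image,
   since theta(0) is invertible; so it is small and can be dropped. *)
Lemma clos1_of_nil f : at0 theta \in unitmx -> clos 0 f -> f [::] = 0 -> clos 1 f.
Proof.
move=> ut [If Hf] f0; split=> // eps e0.
have [M M0 HM] : exists2 M, 0 <= M &
    forall v, N2 (app theta v) <= M * redot (at0 theta *m v) (at0 theta *m v).
  have appA v : app (fun w => theta w *m invmx (at0 theta)) v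
      = app theta (invmx (at0 theta) *m v).
    by apply/funext => w; rewrite /app mulmxA.
  have [|M M0 HM] := @bdd_bound (fun w => theta w *m invmx (at0 theta)).
    by move=> v; rewrite appA; apply: bdd_theta.
  by exists M => // v; have := HM (at0 theta *m v); rewrite appA mulKmx.
(* Dropping the constant term [q [::]] adds an error of squared norm at most [M] times the original
   one, and [N2D_le] doubles both. *)
have M2 : 0 < 2 + 2 * M by rewrite ltr_pwDl // mulr_ge0.
have [m [q [sq vq Nq]]] := Hf _ (divr_gt0 e0 M2); have Iq := inFB If (inF_theta sq).
exists m, (chop q); split; [exact: supp_lt_chop|by case|].
have -> : f - convol theta (chop q) = (f - convol theta q) + app theta (q [::]).
  by rewrite [convol _ q]convol_chop opprD addrA addrAC -[app _ _]/(fun w => _) subrK.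
apply: le_lt_trans (N2D_le Iq (bdd_theta _)) _.
have H1 := HM (q [::]).
have := redot_le_N2 [::] Iq; rewrite subr_convol_nil f0 sub0r.
have -> u : redot (- u) (- u) = redot u u.
  by apply: eq_bigr => i _; rewrite !mxE; case: (u i 0) => a b /=; ring.
move=> H2; have H3 := ler_wpM2l M0 H2.
move: Nq; rewrite ltr_pdivlMr //.
by move: (N2 (f - _)) (N2 (app _ _)) (redot _ _) H1 H2 H3 => x y z; lra.
Qed.

(** Each vanishing constant term raises the order by one through [clos1_of_nil]; then one letter is
    removed and later restored by [clos_cons]. *)
Lemma clos_vanish k f : at0 theta \in unitmx -> clos 0 f -> vanish_lt k f -> clos k f.
Proof.
move=> ut; elim: k f => [//|k IHk] f Hf vf; apply: clos_cons; first exact: vf.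
move=> x; apply: IHk; last exact: vanish_lt_der.
by apply: clos_der; apply: clos1_of_nil => //; apply: vf.
Qed.

End Closure.

(** * The quadratic form of Delta_K and elements of minimal norm *)

Section Wandering.
Variables (R : realType) (n d : nat) (theta : opE R n d).
Local Notation C := R[i].
Local Notation V := (seq 'I_n -> 'cV[C]_d).
Implicit Types (f g p q : V) (c : C) (h u v : 'cV[C]_d).
Local Notation N2 f := (rip f f).

Lemma Re_sum (I : Type) (r : seq I) (P : pred I) (F : I -> C) :
  complex.Re (\sum_(i <- r | P i) F i) = \sum_(i <- r | P i) complex.Re (F i).
Proof. by apply: (big_morph (@complex.Re R)) => // -[a b] [a' b']. Qed.

Lemma Re_gram (A B : opE R n d) u v (K : 'M[C]_d) : bdd A -> bdd B ->
  (forall j l, K j l = ip (app A (Defs.basis R l)) (app B (Defs.basis R j))) ->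
  complex.Re ((adjM v *m K *m u) 0 0) = rip (app A u) (app B v).
Proof.
move=> bA bB HK; rewrite [app A u]app_basis [app B v]app_basis.
rewrite rip_suml; last first.
- by move=> l _; apply/inFZ/bA.
- by apply: inF_sum => j _; apply/inFZ/bB.
rewrite mxE Re_sum; apply: eq_bigr => l _.
rewrite rip_sumr; last first.
- by move=> j _; apply/inFZ/bB.
- exact/inFZ/bA.
rewrite mxE mulr_suml Re_sum; apply: eq_bigr => j _.
by rewrite !mxE HK Re_ipZ.
Qed.

Hypothesis bdd_theta : bdd theta.

(** The shift acts here on operators, so that [Re_gram] applies to the entries of the kernel. *)
Definition shiftM (a : seq 'I_n) (A : opE R n d) : opE R n d :=
  fun b => if prefix a b then A (drop (size a) b) else 0.

Lemma app_shiftM a (A : opE R n d) u : app (shiftM a A) u = shiftw a (app A u).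
Proof.
by apply/funext => b; rewrite /app /shiftM /shiftw; case: ifP; rewrite ?mul0mx.
Qed.

Lemma bdd_shiftM a (A : opE R n d) : bdd A -> bdd (shiftM a A).
Proof. by move=> bA u; rewrite app_shiftM; apply/inF_shiftw/bA. Qed.

(** Hence [DeltaQ] is the infimum of |M_theta p|^2 over polynomials with prescribed constant
    term. *)
Lemma Re_kernel_sum m (p : V) :
  complex.Re (sum_upto m (fun s => sum_upto m (fun w =>
    (adjM (p w) *m Kth theta w s *m p s) 0 0))) = N2 (convol theta (trunc m.+1 p)).
Proof.
rewrite -MopE Mop_sum.
have Is i (t : i.-tuple 'I_n) : inF (shiftw t (app theta (p t))).
  by apply/inF_shiftw/bdd_theta.
have IS : inF (\sum_(i < m.+1) \sum_(t : i.-tuple 'I_n) shiftw t (app theta (p t))).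
  by apply: inF_sum => i _; apply: inF_sum => t _.
rewrite rip_suml //; last by move=> i _; apply: inF_sum.
rewrite Re_sum; apply: eq_bigr => i _; rewrite rip_suml // Re_sum.
apply: eq_bigr => t _; rewrite rip_sumr //; last by move=> j _; apply: inF_sum.
rewrite Re_sum; apply: eq_bigr => j _; rewrite rip_sumr // Re_sum.
apply: eq_bigr => s _; rewrite -!app_shiftM; apply: Re_gram.
- exact: bdd_shiftM.
- exact: bdd_shiftM.
- by move=> k l; rewrite mxE !app_shiftM.
Qed.

(** A real [inf] is meaningful only for a nonempty set that is bounded below. *)
Lemma DeltaQ_set h :
  has_inf [set x : R | exists (m : nat) (hs : V), hs [::] = h /\
        x = complex.Re (sum_upto m (fun s => sum_upto m (fun w =>
              (adjM (hs w) *m Kth theta w s *m hs s) 0 0)))].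
Proof.
split; first by eexists; exists 0%N, (delta_nil h).
exists 0 => _ [m [p [_ ->]]]; rewrite Re_kernel_sum; apply: N2_ge0.
exact: inF_convol bdd_theta (supp_lt_trunc _).
Qed.

Lemma DeltaQ_le m p : supp_lt m p -> DeltaQ (Kth theta) (p [::]) <= N2 (convol theta p).
Proof.
move=> sp; have [_ lb] := DeltaQ_set (p [::]).
apply: ge_inf => //; exists m, p; split=> //.
by rewrite Re_kernel_sum trunc_id //; apply: supp_lt_leq sp.
Qed.

Lemma DeltaQ_adherent h (eps : R) : 0 < eps -> exists m p,
  [/\ supp_lt m p, p [::] = h & N2 (convol theta p) < DeltaQ (Kth theta) h + eps].
Proof.
move=> e0; have [_ [m [p [<- ->]]]] := inf_adherent e0 (DeltaQ_set h).
rewrite Re_kernel_sum => Hp; exists m.+1, (trunc m.+1 p); split=> //.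
exact: supp_lt_trunc.
Qed.

Let D h := DeltaQ (Kth theta) h.

(* The element of minimal norm of the closure of the M_theta p with p(g_0) = h;
   a minimizing sequence is Cauchy by the parallelogram law. *)
Lemma minimizer h : exists w, [/\ inF w, clos theta 1 (w - app theta h) &
  forall m q, supp_lt m q -> vanish_lt 1 q -> rip w (convol theta q) = 0].
Proof.
have h0 m : 0 < (@harmonic R) m by rewrite /harmonic invr_gt0.
(* With the quarter, 2|F_l|^2 + 2|F_m|^2 - 4 D h is at most half of [harmonic l + harmonic m], hence
   at most [harmonic m]. *)
have /choice [s /choice [p Hp]] : forall m, exists s p, [/\ supp_lt s p, p [::] = h &
    N2 (convol theta p) < D h + harmonic m / 4].
  by move=> m; apply: DeltaQ_adherent; rewrite divr_gt0.
pose F m := convol theta (p m).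
have IF m : inF (F m) by have [sp _ _] := Hp m; exact: inF_convol bdd_theta sp.
have cauchyF m l : (m <= l)%N -> N2 (F l - F m) <= harmonic m.
  move=> ml.
  have hl : (@harmonic R) l <= harmonic m.
    by rewrite /harmonic lef_pV2 ?posrE // ler_nat.
  have [sm pm Nm] := Hp m; have [sl pl Nl] := Hp l.
  have mid : D h <= N2 ((2^-1)%:C *: (F l + F m)).
    have {1}-> : h = ((2^-1)%:C *: (p l + p m)) [::].
      rewrite !fctE pl pm; apply/colP => i; rewrite !mxE; case: (h i 0) => a b.
      by apply/eqP; rewrite eq_complex /=; apply/andP; split; apply/eqP; field.
    rewrite -convolD -convolZ; apply: (@DeltaQ_le (maxn (s l) (s m))).
    by apply/supp_ltZ/supp_ltD; [apply: supp_lt_leq sl|apply: supp_lt_leq sm];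
      rewrite ?leq_maxl ?leq_maxr.
  have IFF := inFD (IF l) (IF m).
  move: mid; rewrite (N2Z _ IFF) (N2D (IF l) (IF m)) (N2B (IF l) (IF m)) /=.
  have e4 : (2^-1 : R) ^+ 2 + 0 ^+ 2 = 4^-1 by field.
  rewrite e4.
  move: Nl Nm; rewrite -/(F l) -/(F m).
  rewrite -[m.+1%:R^-1]/(@harmonic R m); by move: (N2 (F l)) (N2 (F m)) (rip (F l) (F m)) => x y z; lra.
have [w Iw Hw] := inF_limit IF cauchyF (@cvg_harmonic R).
exists w; split=> //.
  apply: (clos_limit bdd_theta) => [|eps e0]; first exact: (inFB Iw (bdd_theta h)).
  have /cvgrPdist_lt/(_ _ e0) [m _ Hm] := @cvg_harmonic R.
  have [sp pm _] := Hp m.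
  exists (convol theta (chop (p m))).
    by apply: (clos_convol bdd_theta (supp_lt_chop sp)); case.
  have -> : w - app theta h - convol theta (chop (p m)) = w - F m.
    by rewrite /F [convol _ (p m)]convol_chop pm opprD addrA.
  apply: le_lt_trans (Hw m) _; have := Hm m (leqnn m).
  by rewrite sub0r normrN ger0_norm // ltW.
move=> l q sq vq; set Q := convol theta q.
have IQ : inF Q by exact: inF_convol bdd_theta sq.
(* The 4 comes from (x + y)^2 <= 2 x^2 + 2 y^2, applied to the contributions of [F m] and [w - F m],
   whose squares are each at most [harmonic m * N2 Q]. *)
apply: (@eq0_of_sqr_le _ _ (4 * N2 Q)) => eps e0.
have /cvgrPdist_lt/(_ _ e0) [m _ /(_ m (leqnn m))] := @cvg_harmonic R.
rewrite sub0r normrN ger0_norm ?(ltW (h0 m)) // => /ltW He.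
have [sp pm Nm] := Hp m.
(* Adding t q keeps the constant term [h], so |F m + t Q|^2 - D h is a nonnegative quadratic in t,
   with constant coefficient below [harmonic m]. *)
have r1 : rip (F m) Q ^+ 2 <= harmonic m * N2 Q.
  apply: sqr_le_of_quadratic_ge0 => [|t]; first exact: N2_ge0.
  have : D h <= N2 (F m + t%:C *: Q).
    have {1}-> : h = (p m + t%:C *: q) [::] by rewrite fctE fctE vq // scaler0 addr0.
    rewrite -convolZ -convolD; apply: (@DeltaQ_le (maxn (s m) l)).
    by apply: supp_ltD; [apply: supp_lt_leq sp|apply/supp_ltZ; apply: supp_lt_leq sq];
      rewrite ?leq_maxl ?leq_maxr.
  have ItQ := inFZ t%:C IQ.
  rewrite (N2D (IF m) ItQ) (N2Z _ IQ) ripC (ripZr _ IQ (IF m)) (ripC Q) /=.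
  move: Nm (h0 m); rewrite -/(F m) expr0n addr0 /harmonic /=.
  by move: (N2 (F m)) (N2 Q) (rip (F m) Q) (D h) (m.+1%:R^-1) => x y z D' H; lra.
have Iwm := inFB Iw (IF m).
have r2 : rip (w - F m) Q ^+ 2 <= harmonic m * N2 Q.
  apply: le_trans (rip_sqr_le Iwm IQ) _.
  by rewrite ler_wpM2r ?N2_ge0.
have -> : rip w Q = rip (w - F m) Q + rip (F m) Q.
  by rewrite (ripBl Iw (IF m) IQ) subrK.
move: r1 r2 (ler_wpM2l (N2_ge0 IQ) He).
move: (rip (w - F m) Q) (rip (F m) Q) (N2 Q) (N2_ge0 IQ) => x y z z0.
by have := sqr_ge0 (x - y); move: (harmonic m) => H; nra.
Qed.

End Wandering.

(** * Hermitian matrices *)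

Section Hermitian.
Variables (R : realType) (d : nat).
Local Notation C := R[i].
Implicit Types (H A B P : 'M[C]_d) (h u v : 'cV[C]_d).

Lemma adjM_mul p q r (A : 'M[C]_(p, q)) (B : 'M[C]_(q, r)) :
  adjM (A *m B) = adjM B *m adjM A.
Proof. by rewrite /adjM trmx_mul map_mxM. Qed.

Lemma adjMK p q (A : 'M[C]_(p, q)) : adjM (adjM A) = A.
Proof. by apply/matrixP => i j; rewrite !mxE conjcK. Qed.

Lemma redotE u v : redot u v = complex.Re ((adjM v *m u) 0 0).
Proof.
rewrite mxE Re_sum; apply: eq_bigr => i _; rewrite !mxE.
by case: (u i 0) (v i 0) => a b [a' b'] /=; ring.
Qed.

Lemma det_adjM A : \det (adjM A) = conjc (\det A).
Proof. by rewrite /adjM det_map_mx det_tr. Qed.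

Lemma Re_det_gram A : complex.Re (\det (adjM A *m A)) =
  complex.Re (\det A) ^+ 2 + complex.Im (\det A) ^+ 2.
Proof. by rewrite det_mulmx det_adjM; case: (\det A) => a b /=; ring. Qed.

Lemma Re_det_gram_gt0 A : A \in unitmx -> 0 < complex.Re (\det (adjM A *m A)).
Proof.
rewrite unitmxE unitfE Re_det_gram => H; rewrite lt_def addr_ge0 ?sqr_ge0 // andbT.
apply: contra H; rewrite paddr_eq0 ?sqr_ge0 // !sqrf_eq0.
by case: (\det A) => a b /= /andP [/eqP -> /eqP ->].
Qed.

Lemma hermitian_diagonalization H : adjM H = H -> exists P (r : 'I_d -> R),
  [/\ P *m adjM P = 1%:M, adjM P *m P = 1%:M &
      H = adjM P *m diag_mx (\row_i (r i)%:C) *m P].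
Proof.
move=> hH; have hs : H \is hermsymmx.
  by apply/is_hermitianmxP; rewrite expr0 scale1r; symmetry.
have Pu := spectral_unitarymx H.
exists (spectralmx H), (fun i => complex.Re (spectral_diag H 0 i)); split.
- exact/unitarymxP.
- by have := mulVmx (unitarymx_unit Pu); rewrite invmx_unitary.
have EH := orthomx_spectralP (hermitian_normalmx hs).
have EI : invmx (spectralmx H) = adjM (spectralmx H) by exact: invmx_unitary.
rewrite EI in EH.
have <- : spectral_diag H = \row_i (complex.Re (spectral_diag H 0 i))%:C; last first.
  exact: EH.
apply/rowP => i; rewrite mxE RRe_real //.
by have /mxOverP := hermitian_spectral_diag_real hs; apply.
Qed.

(** Evaluates the form at the i-th column of [adjM P], an eigenvector, so that bounds on the form
    become bounds on eigenvalues. *)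
Lemma eigenvector_form P (r : 'I_d -> R) i : P *m adjM P = 1%:M ->
  complex.Re ((adjM (adjM P *m Defs.basis R i) *m
    (adjM P *m diag_mx (\row_i (r i)%:C) *m P) *m (adjM P *m Defs.basis R i)) 0 0) = r i.
Proof.
move=> PP; rewrite /Defs.basis adjM_mul adjMK -!mulmxA (mulmxA P (adjM P)) PP mul1mx.
rewrite (mulmxA P (adjM P)) PP mul1mx mul_diag_mx mxE (bigD1 i) //= big1 => [|j ji].
  by rewrite !mxE !eqxx andbT mulr1n mulr1 addr0 conjc1 mul1r.
by rewrite !mxE (negPf ji) /= mulr0 mulr0.
Qed.

Lemma hermitian_psd_factor H : adjM H = H ->
  (forall h, 0 <= complex.Re ((adjM h *m H *m h) 0 0)) -> exists B, H = adjM B *m B.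
Proof.
move=> /hermitian_diagonalization [P [r [PP PP' ->]]] pos.
have r0 i : 0 <= r i by rewrite -(eigenvector_form r i PP).
exists (diag_mx (\row_i (Num.sqrt (r i))%:C) *m P).
rewrite adjM_mul !mulmxA; congr (_ *m _); rewrite -!mulmxA; congr (_ *m _).
apply/matrixP => i j; rewrite mul_mx_diag !mxE.
have [->|ij] := eqVneq i j; last by rewrite !mulr0n conjc0 mul0r.
rewrite !mulr1n conjc_real -rmorphM /=.
by rewrite -expr2 sqr_sqrtr.
Qed.

Lemma eq1_of_prod_eq1 (r : 'I_d -> R) :
  (forall i, 1 <= r i) -> \prod_i r i = 1 -> forall i, r i = 1.
Proof.
move=> r1 pr i; apply/eqP; rewrite eq_le r1 andbT -[leRHS]pr (bigD1 i) //=.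
rewrite ler_peMr ?(le_trans ler01) //; elim/big_ind: _ => // x y x1 y1.
by rewrite -[1]mulr1 ler_pM.
Qed.

(* Normalizing by [A], all eigenvalues are at least 1 and their product is 1. *)
Lemma eq_gram_of_det H A : A \in unitmx -> adjM H = H ->
  (forall h, redot (A *m h) (A *m h) <= complex.Re ((adjM h *m H *m h) 0 0)) ->
  complex.Re (\det H) = complex.Re (\det (adjM A *m A)) -> H = adjM A *m A.
Proof.
move=> uA hH HA dH; pose G := adjM (invmx A) *m H *m invmx A.
have HG : H = adjM A *m G *m A.
  rewrite /G !mulmxA -adjM_mul mulVmx // -!mulmxA mulVmx // mulmx1.
  by rewrite (_ : adjM 1%:M = 1%:M) ?mul1mx // /adjM trmx1 map_mx1.
have hG : adjM G = G by rewrite /G !adjM_mul adjMK hH mulmxA.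
have [P [r [PP PP' EG]]] := hermitian_diagonalization hG.
have r1 i : 1 <= r i.
  rewrite -(eigenvector_form r i PP) -EG; set h := adjM P *m Defs.basis R i.
  have := HA (invmx A *m h); rewrite (mulKVmx uA) /G adjM_mul !mulmxA.
  apply: le_trans; rewrite redotE /h /Defs.basis adjM_mul adjMK mulmxA -(mulmxA _ P) PP mulmx1.
  rewrite mxE (bigD1 i) //= big1 => [|j ji].
    by rewrite !mxE !eqxx andbT mulr1n conjc1 mulr1 addr0.
  by rewrite !mxE (negPf ji) /= mulr0.
clearbody G; have dG : \det G = (\prod_i r i)%:C.
  rewrite EG !det_mulmx mulrAC -det_mulmx PP' det1 mul1r det_diag rmorph_prod.
  by apply: eq_bigr => i _; rewrite mxE.
have pr : \prod_i r i = 1.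
  have d0 := Re_det_gram_gt0 uA.
  apply: (mulfI (lt0r_neq0 d0)); rewrite mulr1 -[RHS]dH HG !det_mulmx dG.
  by rewrite mulrAC; case: (_ * \det A) => a b /=; ring.
rewrite {1}HG EG (_ : diag_mx _ = 1%:M) ?mulmx1 ?PP' ?mulmx1 //.
apply/matrixP => i j; rewrite !mxE (eq1_of_prod_eq1 r1 pr) rmorph1.
by [].
Qed.

Lemma unitmx_of_inj A : (forall h, A *m h = 0 -> h = 0) -> A \in unitmx.
Proof.
move=> inj; rewrite -unitmx_tr -row_free_unit -kermx_eq0; apply/eqP/row_matrixP => i.
rewrite row0; apply: trmx_inj; rewrite trmx0; apply: inj.
by rewrite -{1}[A]trmxK -trmx_mul -row_mul mulmx_ker row0 trmx0.
Qed.

Lemma redot_gram A h : redot (A *m h) (A *m h) =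
  complex.Re ((adjM h *m (adjM A *m A) *m h) 0 0).
Proof. by rewrite redotE adjM_mul !mulmxA. Qed.

(** The difference is Hermitian with vanishing form, so all its eigenvalues are 0. *)
Lemma eq_gram_of_form H A : adjM H = H ->
  (forall h, complex.Re ((adjM h *m H *m h) 0 0) = redot (A *m h) (A *m h)) ->
  H = adjM A *m A.
Proof.
move=> hH HA; pose X := H - adjM A *m A.
have hX : adjM X = X.
  have adjMB (M N : 'M[C]_d) : adjM (M - N) = adjM M - adjM N.
    by apply/matrixP => i j; rewrite !mxE rmorphB.
  by rewrite /X adjMB hH adjM_mul adjMK.
have X0 h : complex.Re ((adjM h *m X *m h) 0 0) = 0.
  have ReB (M N : 'M[C]_1) : complex.Re ((M - N) 0 0) =
      complex.Re (M 0 0) - complex.Re (N 0 0).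
    by rewrite !mxE; case: (M 0 0) (N 0 0) => a b [].
  by rewrite mulmxBr mulmxBl ReB HA redot_gram subrr.
have [P [r [PP PP' EX]]] := hermitian_diagonalization hX.
apply/eqP; rewrite -subr_eq0 -/X EX (_ : diag_mx _ = 0) ?mulmx0 ?mul0mx //.
apply/matrixP => i j; rewrite !mxE -(eigenvector_form r i PP) -EX X0.
by rewrite mul0rn.
Qed.

End Hermitian.

(** * Truncation by degree *)

Section Truncation.
Variables (R : realType) (n d : nat).
Local Notation C := R[i].
Local Notation V := (seq 'I_n -> 'cV[C]_d).
Implicit Types (f g p q : V) (c : C) (h u v : 'cV[C]_d).
Local Notation N2 f := (rip f f).

Lemma pip_eq0 k f g : vanish_lt k g -> pip k f g = 0.
Proof.
move=> vg; apply: big1 => i _; apply: big1 => t _.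
by rewrite vg ?size_tuple // redotC redot0l.
Qed.

Lemma pip_trunc k f g : pip k (trunc k f) g = pip k f g.
Proof.
by apply: eq_bigr => i _; apply: eq_bigr => t _; rewrite /trunc size_tuple ltn_ord.
Qed.

Lemma inF_supp m f : supp_lt m f -> inF f.
Proof.
elim: m f => [|m IHm] f sf; first by rewrite (supp_lt0 sf); apply: inF0.
by apply: inF_rec => x; apply/IHm/supp_lt_der.
Qed.

Lemma rip_supp m f g : supp_lt m f -> inF g -> rip f g = pip m f g.
Proof.
elim: m f g => [|m IHm] f g sf Ig.
  by rewrite (supp_lt0 sf) rip0l /pip big_ord0.
rewrite pip_rec rip_rec //; last exact: inF_supp sf.
congr (_ + _); apply: eq_bigr => x _; apply: IHm; first exact: supp_lt_der.
exact: inF_der.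
Qed.

Lemma rip_trunc k f g : inF g -> rip (trunc k f) g = pip k f g.
Proof. by move=> Ig; rewrite (rip_supp (supp_lt_trunc f) Ig) pip_trunc. Qed.

Lemma inF_trunc k f : inF (trunc k f).
Proof. exact: inF_supp (supp_lt_trunc f). Qed.

Lemma N2_trunc k f : N2 (trunc k f) = pip k f f.
Proof.
rewrite rip_trunc; last exact: inF_trunc.
by rewrite pipC pip_trunc.
Qed.

Lemma rip_delta_nil v g : inF g -> rip (delta_nil v) g = redot v (g [::]).
Proof.
move=> Ig; rewrite (rip_supp (supp_lt_delta_nil (T:='I_n) v) Ig) pip_rec.
by rewrite big1 ?addr0 // => x _; rewrite /pip big_ord0.
Qed.

Lemma vanish_lt_subr_trunc k f : vanish_lt k (f - trunc k f).
Proof. by move=> w kw; rewrite !fctE /trunc kw subrr. Qed.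

Lemma N2_subr_trunc k f : inF f -> N2 (f - trunc k f) = N2 f - pip k f f.
Proof.
move=> If; have It := inF_trunc k f.
by rewrite (N2B If It) N2_trunc ripC rip_trunc //; ring.
Qed.

Lemma N2_subr_trunc_lt f (eps : R) : inF f -> 0 < eps ->
  exists k, N2 (f - trunc k f) < eps.
Proof.
move=> If e0; have /cvgrPdist_lt/(_ _ e0) [k _ /(_ k (leqnn k)) Hk] := cvg_pip If If.
exists k; rewrite (N2_subr_trunc k If); apply: le_lt_trans Hk; exact: ler_norm.
Qed.

Lemma N2_shiftw a f : inF f -> N2 (shiftw a f) = N2 f.
Proof.
move=> If; elim: a => [|x a IHa].
  suff -> : shiftw [::] f = f by [].
  by apply/funext => b; rewrite /shiftw prefix0s drop0.
have Is := inF_shiftw (x :: a) If; rewrite (rip_rec Is Is) redot0l add0r.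
rewrite (bigD1 x) //= der_shiftw eqxx IHa big1 ?addr0 // => y /negPf yx.
by rewrite der_shiftw eq_sym yx rip0l.
Qed.

(** The polarization in [ip] sees only these norms; this turns equality of norms into equality of
    kernels. *)
Lemma eq_ip f g f' g' : (forall c : C, sqnorm (fadd f (fscale c g)) =
  sqnorm (fadd f' (fscale c g'))) -> ip f g = ip f' g'.
Proof. by move=> H; rewrite /ip; under eq_bigr => k _ do rewrite H. Qed.

End Truncation.

(** * The wandering subspace and the outer part *)

Section Factorization.
Variables (R : realType) (n d : nat) (theta : opE R n d).
Local Notation C := R[i].
Local Notation V := (seq 'I_n -> 'cV[C]_d).
Implicit Types (f g p q : V) (c : C) (h u v : 'cV[C]_d).
Local Notation N2 f := (rip f f).
Hypothesis bdd_theta : bdd theta.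

(* [app W h] is the projection of theta h onto the wandering subspace of the
   closure of the range of M_theta. *)
Definition wandering (W : opE R n d) := [/\ bdd W,
  forall h, clos theta 1 (app W h - app theta h) &
  forall h m q, supp_lt m q -> vanish_lt 1 q -> rip (app W h) (convol theta q) = 0].

(** Minimizers for the [d] basis vectors serve as columns; the conditions are linear and extend to
    every [h]. *)
Lemma wandering_exists : exists W, wandering W.
Proof.
have /choice [w Hw] := fun l => minimizer bdd_theta (Defs.basis R l).
pose W : opE R n d := fun b => \matrix_(i, l) w l b i 0.
have We l : app W (Defs.basis R l) = w l.
  by apply/funext => b; rewrite /app -colE; apply/colP => i; rewrite !mxE.
have Iw l : inF (w l) by have [] := Hw l.
have WE h : app W h = \sum_l h l 0 *: w l.
  by rewrite app_basis; apply: eq_bigr => l _; rewrite We.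
exists W; split=> [h|h|h m q sq vq].
- by rewrite WE; apply: inF_sum => l _; apply: inFZ.
- rewrite WE [app theta h]app_basis -sumrB.
  apply: (clos_sum bdd_theta) => l _; rewrite -scalerBr; apply: closZ => //.
  by have [] := Hw l.
- have Iq := inF_convol bdd_theta sq.
  rewrite WE rip_suml //; last by move=> l _; apply: inFZ.
  apply: big1 => l _; rewrite ripZl -convolZ; have [_ _] := Hw l; apply.
    exact: supp_ltZ sq.
  exact: vanish_ltZ.
Qed.

Variable W : opE R n d.
Hypothesis HW : wandering W.

Lemma wandering_bdd : bdd W. Proof. by case: HW. Qed.

Lemma wandering_clos0 h : clos theta 0 (app W h).
Proof.
have [_ Wc _] := HW; rewrite -(subrK (app theta h) (app W h)); apply: closD => //.
  exact: clos_leq (Wc h).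
by rewrite appE; apply: (clos_convol bdd_theta (supp_lt_delta_nil h)).
Qed.

Lemma wandering_orth h g : clos theta 1 g -> rip (app W h) g = 0.
Proof.
have [bW _ Wo] := HW; move=> Hg.
by apply: (rip_clos_eq0 bdd_theta) Hg => // m q; apply: Wo.
Qed.

Lemma wandering_nil h : W [::] *m h = at0 theta *m h.
Proof.
have [_ Wc _] := HW; have /eqP := clos_nil bdd_theta (Wc h).
by rewrite fctE subr_eq0 => /eqP.
Qed.

(** The difference between M_theta p and W p(g_0) lies in [clos theta 1], to which the range of [W]
    is orthogonal. *)
Lemma wandering_pythagoras m p : supp_lt m p -> N2 (convol theta p) =
  N2 (app W (p [::])) + N2 (convol theta p - app W (p [::])).
Proof.
move=> sp; have [bW Wc _] := HW; set h := p [::].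
have cg : clos theta 1 (convol theta p - app W h).
  have -> : convol theta p - app W h = convol theta (chop p) - (app W h - app theta h).
    by rewrite [convol _ p]convol_chop -[fun w => _]/(app theta h) opprB addrCA addrA.
  apply: closB => //; apply: (clos_convol bdd_theta (supp_lt_chop sp)); by case.
rewrite -{1 2}(subrKC (app W h) (convol theta p)).
have [Ig _] := cg.
by rewrite (N2D (bW h) Ig) (wandering_orth h cg); ring.
Qed.

(** Pythagoras gives the lower bound; it is approached by adding to [h] an approximant of W h -
    theta h, an element of [clos theta 1]. *)
Lemma DeltaQ_wandering h : DeltaQ (Kth theta) h = N2 (app W h).
Proof.
have [bW Wc _] := HW; apply/eqP; rewrite eq_le; apply/andP; split.
  apply/ler_addgt0Pr => eps e0; have [Ig /(_ _ e0) [m [q [sq vq Nq]]]] := Wc h.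
  pose p : V := delta_nil h + q.
  have sp : supp_lt m.+1 p.
    by apply: supp_ltD; [apply: supp_lt_leq (supp_lt_delta_nil h)|apply: supp_lt_leq sq].
  have ph : p [::] = h by rewrite /p fctE vq // addr0.
  have := DeltaQ_le bdd_theta sp; rewrite ph => /le_trans; apply.
  rewrite (wandering_pythagoras sp) ph lerD2l; apply: le_trans (ltW Nq).
  have Iq := inFB Ig (inF_convol bdd_theta sq).
  rewrite -(N2N Iq) /p convolD convol_delta_nil -[fun w => _]/(app theta h).
  by rewrite [X in _ <= rip X X]opprB opprB addrCA addrA.
apply/ler_addgt0Pr => eps e0.
have [m [p [sp <- /ltW Np]]] := DeltaQ_adherent bdd_theta h e0.
apply: le_trans Np; rewrite (wandering_pythagoras sp) lerDl.
exact/N2_ge0/inFB/bW/(inF_convol bdd_theta sp).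
Qed.

Lemma redot_le_DeltaQ h : redot (at0 theta *m h) (at0 theta *m h) <= DeltaQ (Kth theta) h.
Proof.
rewrite DeltaQ_wandering -wandering_nil.
exact: (redot_le_N2 [::] (wandering_bdd h)).
Qed.

(** [Delta] and [ip] polarize with the same four combinations, so Delta_K is the Gram matrix of the
    columns of [W]. *)
Lemma Delta_wandering j l : Delta (Kth theta) j l =
  ip (app W (Defs.basis R l)) (app W (Defs.basis R j)).
Proof.
rewrite mxE /ip; congr (_ * _); apply: eq_bigr => k _; congr (_ * _%:C).
rewrite DeltaQ_wandering appDr appZr.
set F := app W (Defs.basis R l); set G := app W (Defs.basis R j).
rewrite -[fadd F _]/(F + 'i%R ^+ k *: G) sqnorm_rip //.
by apply: inFD; [|apply: inFZ]; apply: wandering_bdd.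
Qed.

Lemma adjM_Delta : adjM (Delta (Kth theta)) = Delta (Kth theta).
Proof.
apply/matrixP => i j; rewrite mxE mxE !Delta_wandering -ip_conj //; exact: wandering_bdd.
Qed.

Lemma Delta_form h : complex.Re ((adjM h *m Delta (Kth theta) *m h) 0 0) =
  DeltaQ (Kth theta) h.
Proof.
rewrite DeltaQ_wandering; apply: Re_gram; [exact: wandering_bdd|exact: wandering_bdd|].
exact: Delta_wandering.
Qed.

Hypothesis unit_theta : at0 theta \in unitmx.
Variable B : 'M[C]_d.
Hypothesis DeltaB : Delta (Kth theta) = adjM B *m B.

Lemma redotB h : redot (B *m h) (B *m h) = DeltaQ (Kth theta) h.
Proof. by rewrite redot_gram -DeltaB Delta_form. Qed.

Lemma unitB : B \in unitmx.
Proof.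
apply: unitmx_of_inj => h Bh; have := redot_le_DeltaQ h.
rewrite -redotB Bh redot0l => /redot_eq0 /(congr1 (mulmx (invmx (at0 theta)))).
by rewrite mulKmx // mulmx0.
Qed.

(* [U] is inner: an orthonormal basis of the wandering subspace. *)
Let U : opE R n d := fun w => W w *m invmx B.

Let appU h : app U h = app W (invmx B *m h).
Proof. by apply/funext => w; rewrite /app mulmxA. Qed.

Let bddU : bdd U. Proof. by move=> h; rewrite appU; apply: wandering_bdd. Qed.

Let N2U h : N2 (app U h) = redot h h.
Proof. by rewrite appU -DeltaQ_wandering -redotB mulKVmx // unitB. Qed.

Let U_nil : U [::] = at0 theta *m invmx B.
Proof.
rewrite /U; congr (_ *m _); apply/matrixP => i j.
have := wandering_nil (Defs.basis R j); rewrite -!colE => /colP/(_ i).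
by rewrite !mxE.
Qed.

Let clos_convolU m p : supp_lt m p ->
  clos theta 0 (convol U p) /\ (p [::] = 0 -> clos theta 1 (convol U p)).
Proof.
elim: m p => [|m IHm] p sp.
  by rewrite (supp_lt0 sp) convol0r; split=> [|_]; apply: clos0.
have c1 q : supp_lt m.+1 q -> q [::] = 0 -> clos theta 1 (convol U q).
  move=> sq q0; apply: clos_cons => // [|x]; first by rewrite /= q0 mulmx0.
  by rewrite der_convol0 //; have [] := IHm (der x q) (supp_lt_der x sq).
split=> [|p0]; last exact: c1.
rewrite convol_chop; apply: closD => //.
  by rewrite -[fun w => _]/(app U (p [::])) appU; apply: wandering_clos0.
by apply: clos_leq (c1 _ (supp_lt_chop sp) _).
Qed.

(** M_U is isometric on polynomials: the part without constant term is sent into [clos theta 1],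
    orthogonal to the wandering vectors. *)
Let N2_convolU m p : supp_lt m p -> N2 (convol U p) = pip m p p.
Proof.
elim: m p => [|m IHm] p sp.
  by rewrite (supp_lt0 sp) convol0r rip0l /pip big_ord0.
have sc := supp_lt_chop sp; have [_ /(_ erefl) c1] := clos_convolU sc.
have Ic := inF_convol bddU sc.
rewrite convol_chop -[fun w => _]/(app U (p [::])) (N2D (bddU _) Ic) N2U.
rewrite {1}appU (wandering_orth _ c1) mulr0 addr0 pip_rec; congr (_ + _).
rewrite (rip_rec Ic Ic) /= mulmx0 redot0l add0r; apply: eq_bigr => x _.
by rewrite der_convol0 //; apply/IHm/supp_lt_der.
Qed.

Let orth_convolU k m p q : supp_lt k p -> supp_lt m q -> vanish_lt k q ->
  rip (convol U p) (convol theta q) = 0.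
Proof.
elim: k m p q => [|k IHk] m p q sp sq vq.
  by rewrite (supp_lt0 sp) convol0r rip0l.
have Iq := inF_convol bdd_theta sq; have sc := supp_lt_chop sp.
have Ic := inF_convol bddU sc; have q0 : q [::] = 0 by apply: vq.
rewrite convol_chop -[fun w => _]/(app U (p [::])) (ripDl (bddU _) Ic Iq).
rewrite appU wandering_orth; last first.
  by apply: (clos_convol bdd_theta sq); case.
rewrite add0r (rip_rec Ic Iq) /= mulmx0 redot0l add0r; apply: big1 => x _.
rewrite !der_convol0 //; apply: (IHk m); first exact: supp_lt_der.
  by apply: supp_lt_der; apply: supp_lt_leq sq.
exact: vanish_lt_der.
Qed.

(** The solution of U psi = theta in formal series; square summability is established afterwards. *)
Definition outer_part : opE R n d := fun w => convol_div U w theta.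
Local Notation psi := outer_part.

Let unitU : U [::] \in unitmx.
Proof. by rewrite U_nil unitmx_mul unit_theta unitmx_inv unitB. Qed.

Let convolU_psi : convol U psi = theta. Proof. exact: convol_divK unitU. Qed.

Lemma outer_part_nil : at0 psi = B.
Proof.
have tE : theta [::] = U [::] *m B by rewrite U_nil mulmxKV // unitB.
by rewrite /at0 /outer_part /= tE mulKmx.
Qed.

(* [a] below is the partial sum of degree less than [k] of M_U c; the remainder [f - a] is
   orthogonal to it and is dominated by the tail of [f], which yields Parseval's
   identity for [f] along the shifts of [U]. *)
Lemma convol_outer_part m p : supp_lt m p ->
  inF (convol psi p) /\ N2 (convol psi p) = N2 (convol theta p).
Proof.
move=> sp; set f := convol theta p; set c := convol psi p.
have If : inF f := inF_convol bdd_theta sp.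
have fE : f = convol U c by rewrite /c convolA convolU_psi.
have main k : pip k f f <= pip k c c <= N2 f.
  pose a := convol U (trunc k c); have sc := supp_lt_trunc (k := k) c.
  have Ia : inF a := inF_convol bddU sc.
  have Na : N2 a = pip k c c.
    by rewrite (N2_convolU sc) pip_trunc pipC pip_trunc.
  (* By causality, truncating [c] does not change the product below degree [k]; [clos_vanish] then
     places [f - a] in [clos theta k]. *)
  have va : vanish_lt k (f - a).
    move=> w wk; rewrite !fctE fE /a (@convol_eq _ _ _ _ _ U c (trunc k c)) ?subrr //.
    by move=> v vw; rewrite /trunc (leq_ltn_trans vw wk).
  have ca : clos theta k (f - a).
    apply: clos_vanish => //; apply: closB => //.
      by apply: (clos_convol bdd_theta sp).
    by have [] := clos_convolU sc.
  have Iga := inFB If Ia.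
  have o1 : rip a (f - a) = 0.
    by apply: (rip_clos_eq0 bdd_theta Ia) ca => l q sq vq; apply: orth_convolU sc sq vq.
  have Nf : N2 f = N2 a + N2 (f - a).
    by rewrite -{1 2}(subrKC a f) (N2D Ia Iga) o1; ring.
  have It := inF_trunc k f.
  (* [f - a] is orthogonal to both [trunc k f] and [a], so its inner product with the tail of [f] is
     its own squared norm. *)
  have Ng : N2 (f - a) <= N2 (f - trunc k f).
    have : rip (f - a) (f - trunc k f) = N2 (f - a).
      rewrite (ripBr If It Iga) (ripC _ (trunc k f)) rip_trunc // pip_eq0 // subr0.
      by rewrite -{2}(subrKC a f) (ripDr Ia Iga Iga) (ripC _ a) o1 add0r.
    by have := rip_le_half Iga (inFB If It); lra.
  move: Ng; rewrite N2_subr_trunc // -Na; have := N2_ge0 Iga; lra.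
have Ic : inF c by exists (N2 f) => k; have /andP[] := main k.
split=> //; apply/eqP; rewrite eq_le; apply/andP; split.
  by apply: N2_le => // k; have /andP[] := main k.
apply: N2_le => // k; have /andP[H _] := main k.
exact: le_trans H (pip_le k Ic).
Qed.

Lemma bdd_outer_part : bdd psi.
Proof.
by move=> u; rewrite appE; have [] := convol_outer_part (supp_lt_delta_nil u).
Qed.

Lemma supp_lt_shiftw a h : supp_lt (size a).+1 (shiftw a (delta_nil h) : V).
Proof.
move=> w; rewrite /shiftw; case: prefixP => // -[b ->]; rewrite size_cat drop_size_cat //.
by case: b => [|//]; rewrite addn0 ltnn.
Qed.

(** Each kernel entry is read off the norms of M_A p with p = e_w (x) e_l + c e_s (x) e_j, and these
    agree for both operators. *)
Lemma Kth_outer_part : Kth psi = Kth theta.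
Proof.
apply/funext => s; apply/funext => w; apply/matrixP => j l; rewrite [LHS]mxE [RHS]mxE.
apply: eq_ip => c.
pose p : V := shiftw w (delta_nil (Defs.basis R l)) + c *: shiftw s (delta_nil (Defs.basis R j)).
have sp : supp_lt (maxn (size w) (size s)).+1 p.
  apply: supp_ltD; last apply: supp_ltZ.
    by apply: (supp_lt_leq _ (@supp_lt_shiftw w _)); rewrite ltnS leq_maxl.
  by apply: (supp_lt_leq _ (@supp_lt_shiftw s _)); rewrite ltnS leq_maxr.
have E (A : opE R n d) : fadd (shiftw w (app A (Defs.basis R l)))
    (fscale c (shiftw s (app A (Defs.basis R j)))) = convol A p.
  by rewrite convolD convolZ !convol_shiftw -!appE.
have [Ip Np] := convol_outer_part sp.
by rewrite !E (sqnorm_rip Ip) Np (sqnorm_rip (inF_convol bdd_theta sp)).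
Qed.

End Factorization.

(** * The equivalences *)

Section Equivalence.
Variables (R : realType) (n d : nat) (theta : opE R n d).
Local Notation C := R[i].
Local Notation V := (seq 'I_n -> 'cV[C]_d).
Implicit Types (f g p q : V) (c : C) (h u v : 'cV[C]_d).
Local Notation N2 f := (rip f f).
Hypothesis bdd_theta : bdd theta.

Lemma outerP : outer theta <-> forall g, inF g -> clos theta 0 g.
Proof.
split=> [ot g Ig|ct g /inFockP Ig eps e0].
  split=> // eps e0.
  have [||m [q]] := ot g _ (Num.sqrt eps); [exact/inFockP|by rewrite sqrtr_gt0|].
  rewrite MopE sqr_sqrtr ?(ltW e0) //; set r := trunc _ q.
  have sr : supp_lt m.+1 r := supp_lt_trunc q.
  rewrite -[fadd _ _]/(g - convol theta r) sqnorm_rip ?lte_fin => [Nr|].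
    by exists m.+1, r.
  exact: (inFB Ig (inF_convol bdd_theta sr)).
have [_ /(_ _ (exprn_gt0 2 e0)) [m [q [sq _ Nq]]]] := ct g Ig.
exists m, q; rewrite MopE (trunc_id (supp_lt_leq (leqnSn m) sq)).
rewrite -[fadd _ _]/(g - convol theta q) sqnorm_rip ?lte_fin //.
exact: (inFB Ig (inF_convol bdd_theta sq)).
Qed.

Lemma N2_convol_Kth (psi : opE R n d) m p : bdd psi -> Kth psi = Kth theta ->
  supp_lt m p -> N2 (convol psi p) = N2 (convol theta p).
Proof.
move=> bpsi K sp; have tp := trunc_id (supp_lt_leq (leqnSn m) sp).
have := Re_kernel_sum bpsi m p; rewrite K tp => <-.
by rewrite (Re_kernel_sum bdd_theta) tp.
Qed.

(** If u is orthogonal to the range of theta(0), the constant term alone keeps every M_theta q at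
    distance at least |u| from e_(g_0) (x) u, so density forces u = 0. *)
Lemma outer_unitmx : outer theta -> at0 theta \in unitmx.
Proof.
move=> /outerP ot.
have : adjM (at0 theta) \in unitmx.
  apply: unitmx_of_inj => u Au; apply: redot_eq0; apply/ler_addgt0Pr => eps e0.
  have Iu : inF (delta_nil u : V) := inF_supp (supp_lt_delta_nil u).
  have [_ /(_ _ e0) [m [q [sq _ /ltW Nq]]]] := ot _ Iu.
  rewrite add0r; apply: le_trans Nq.
  apply: le_trans (redot_le_N2 [::] (inFB Iu (inF_convol bdd_theta sq))).
  rewrite subr_convol_nil /=; set v := at0 theta *m _.
  have uv : redot v u = 0.
    by rewrite redotE /v mulmxA -[at0 theta]adjMK -adjM_mul Au !mxE big1 // => i _; rewrite !mxE rmorph0 mul0r.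
  have -> : u - v = u + (-1)%:C *: v by rewrite rmorphN1 scaleN1r.
  rewrite redotDl redotZr !(redotC _ (u + _)) !redotDl !redotZr (redotC u v) uv.
  by have := redot_ge0 v; lra.
by rewrite !unitmxE det_adjM !unitfE conjc_eq0.
Qed.

Lemma outer_maximal (psi : opE R n d) k p : outer theta -> bdd psi ->
  Kth psi = Kth theta ->
  N2 (trunc k (convol psi (trunc k p))) <= N2 (trunc k (convol theta (trunc k p))).
Proof.
move=> ot bpsi K; have ut := outer_unitmx ot; set r := trunc k p.
have sr : supp_lt k r := supp_lt_trunc p.
set f := convol theta r; have If : inF f := inF_convol bdd_theta sr.
have It : inF (trunc k f) := inF_trunc k f.
(* The tail is thus approximated by M_theta q with q of order at least [k]; replacing r by r - q
   leaves M_psi r unchanged below degree [k]. *)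
have cg : clos theta k (f - trunc k f).
  apply: (clos_vanish bdd_theta ut _ (vanish_lt_subr_trunc (k := k) f)).
  exact: (outerP.1 ot _ (inFB If It)).
apply/ler_addgt0Pr => eps e0; have [Ig /(_ _ e0) [m [q [sq vq /ltW Nq]]]] := cg.
rewrite -(lerD2l (N2 (trunc k f))) in Nq; apply: le_trans Nq.
have sd : supp_lt (maxn k m) (r - q).
  rewrite -scaleN1r; apply: supp_ltD; first exact: supp_lt_leq (leq_maxl _ _) sr.
  by apply: supp_ltZ; apply: supp_lt_leq (leq_maxr _ _) sq.
have -> : trunc k (convol psi r) = trunc k (convol psi (r - q)).
  apply/funext => w; rewrite /trunc; case: ifP => [wk|_]; last by [].
  apply: convol_eq => v vw; rewrite (subr_vanish r vq (leq_ltn_trans vw wk)).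
  by [].
rewrite N2_trunc; apply: le_trans (pip_le k (inF_convol bpsi sd)) _.
rewrite (N2_convol_Kth bpsi K sd) convolB -/f.
have Iq := inF_convol bdd_theta sq; have Igq := inFB Ig Iq.
have -> : f - convol theta q = trunc k f + (f - trunc k f - convol theta q).
  by rewrite addrA subrKC.
have v0 : vanish_lt k (f - trunc k f - convol theta q).
  move=> w wk; rewrite (subr_vanish _ (convol_vanish theta vq) wk).
  exact: (vanish_lt_subr_trunc f wk).
by rewrite (N2D It Igq) (rip_trunc k f Igq) (pip_eq0 f v0) mulr0 addr0.
Qed.

Lemma outer_of_DeltaQ : at0 theta \in unitmx ->
  (forall h, DeltaQ (Kth theta) h = redot (at0 theta *m h) (at0 theta *m h)) ->
  outer theta.
Proof.
move=> ut HD; apply/outerP.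
have cd v : clos theta 0 (delta_nil v).
  have Iv : inF (delta_nil v : V) := inF_supp (supp_lt_delta_nil v).
  split=> // eps e0; pose h := invmx (at0 theta) *m v.
  have [m [p [sp ph Np]]] := DeltaQ_adherent bdd_theta h e0.
  exists m, p; split=> //; have Ip := inF_convol bdd_theta sp.
  (* Since theta(0) h = v, the cross term is |v|^2 and the squared distance is |M_theta p|^2 -
     |v|^2, which [HD] makes smaller than [eps]. *)
  rewrite (N2B Iv Ip) !rip_delta_nil //=.
  rewrite -/(at0 theta) ph mulKVmx //.
  by move: Np; rewrite HD mulKVmx //; lra.
have cs m g : supp_lt m g -> clos theta 0 g.
  elim: m g => [|m IHm] g sg; first by rewrite (supp_lt0 sg); apply: clos0.
  rewrite [g]delta_nil_chop; apply: closD => //.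
  apply: (clos_leq (k := 1)) => //; apply: clos_cons => // x.
  by apply/IHm/(supp_lt_der x sg).
move=> g Ig; apply: clos_limit => // eps e0.
have [k Hk] := N2_subr_trunc_lt Ig e0.
by exists (trunc k g) => //; apply: cs (supp_lt_trunc g).
Qed.

Lemma Delta_of_maximal k : at0 theta \in unitmx ->
  (forall psi : opE R n d, bdd psi -> Kth psi = Kth theta -> forall p,
    N2 (trunc k.+1 (convol psi (trunc k.+1 p))) <=
    N2 (trunc k.+1 (convol theta (trunc k.+1 p)))) ->
  Delta (Kth theta) = adjM (at0 theta) *m at0 theta.
Proof.
move=> ut Hmax; have [W HW] := wandering_exists bdd_theta.
have hD := adjM_Delta bdd_theta HW; have fD := Delta_form bdd_theta HW.
have [B DB] : exists B : 'M[C]_d, Delta (Kth theta) = adjM B *m B.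
  apply: hermitian_psd_factor => // h; rewrite fD.
  exact: le_trans (redot_ge0 _) (redot_le_DeltaQ bdd_theta HW h).
(* A word of length [k], or the empty word when there is no letter: only the constant
   term of M_A survives when it is applied to [e_a (x) h] and truncated. *)
have [a [ak amax]] : exists a : seq 'I_n, (size a <= k)%N /\
    forall b, (size (a ++ b) <= k)%N -> b = [::].
  case: n => [|n']; first by exists [::]; split=> // -[|[]].
  exists (nseq k ord0); rewrite size_nseq leqnn; split=> // b.
  by rewrite size_cat size_nseq -[leqRHS]addn0 leq_add2l leqn0 => /nilP.
have test (A : opE R n d) h : bdd A -> N2 (trunc k.+1 (convol A (trunc k.+1
    (shiftw a (delta_nil h))))) = redot (at0 A *m h) (at0 A *m h).
  move=> bA; rewrite [trunc _ (shiftw _ _)]trunc_id; last first.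
    by apply: (supp_lt_leq _ (@supp_lt_shiftw _ _ _ a h)); rewrite ltnS.
  rewrite convol_shiftw -appE.
  have -> : trunc k.+1 (shiftw a (app A h)) = shiftw a (delta_nil (at0 A *m h)).
    apply/funext => w; rewrite /trunc /shiftw ltnS.
    case: prefixP => [[b ->]|]; last by rewrite if_same.
    rewrite drop_size_cat //; case: leqP => [/amax -> //|].
    by case: b => //; rewrite cats0 ltnNge ak.
  have Id (v : 'cV[C]_d) : inF (delta_nil v : V) := inF_supp (supp_lt_delta_nil v).
  by rewrite N2_shiftw // rip_delta_nil.
have := Hmax _ (bdd_outer_part bdd_theta HW ut DB) (Kth_outer_part bdd_theta HW ut DB).
move=> {}Hmax; apply: eq_gram_of_form => // h; rewrite fD; apply/eqP; rewrite eq_le.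
rewrite (redot_le_DeltaQ bdd_theta HW) andbT -(redotB bdd_theta HW DB).
have := Hmax (shiftw a (delta_nil h)).
rewrite !test //; last exact: bdd_outer_part.
by rewrite (outer_part_nil bdd_theta HW ut DB).
Qed.

Lemma outer_of_det : at0 theta \in unitmx ->
  complex.Re (\det (Delta (Kth theta))) =
    complex.Re (\det (adjM (at0 theta) *m at0 theta)) -> outer theta.
Proof.
move=> ut dD; have [W HW] := wandering_exists bdd_theta.
have fD := Delta_form bdd_theta HW.
have DE : Delta (Kth theta) = adjM (at0 theta) *m at0 theta.
  apply: eq_gram_of_det => //; first exact: adjM_Delta HW.
  by move=> h; rewrite fD; apply: redot_le_DeltaQ HW h.
by apply: outer_of_DeltaQ => // h; rewrite -fD DE redot_gram.
Qed.

(** A finite value excludes the [-oo] branch, so the determinant has positive real part, and [ln] is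
    injective there. *)
Lemma eK_eq_ln (K : Defs.kernel R n d) (x : R) : 0 < x ->
  eK K = (ln x)%:E -> complex.Re (\det (Delta K)) = x.
Proof.
move=> x0; rewrite /eK; case: ifP => // D0 [].
by apply: ln_inj; rewrite posrE.
Qed.

End Equivalence.

(** * The scalar case *)

Section Scalar.
Variables (R : realType) (n : nat).
Implicit Types f : seq 'I_n -> R[i].

Lemma bdd_scal_op f : inFock (fun a => (f a)%:M : 'cV[R[i]]_1) -> bdd (scal_op f).
Proof.
move=> /inFockP If u; suff -> : app (scal_op f) u =
  u 0 0 *: ((fun a => (f a)%:M) : seq 'I_n -> 'cV[R[i]]_1) by exact: inFZ.
apply/funext => a; apply/colP => i; rewrite fctE /app /scal_op mul_scalar_mx !mxE.
by rewrite !ord1 mulr1n mulrC.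
Qed.

Lemma unitmx_scal_op f : (at0 (scal_op f) \in unitmx) = (f [::] != 0).
Proof. by rewrite /at0 /scal_op unitmxE det_scalar1 unitfE. Qed.

Lemma Re_det_scal_op f :
  complex.Re (\det (adjM (at0 (scal_op f)) *m at0 (scal_op f))) =
  complex.Re (f [::]) ^+ 2 + complex.Im (f [::]) ^+ 2.
Proof. by rewrite Re_det_gram /at0 /scal_op det_scalar1. Qed.

End Scalar.

Theorem mainTheorem9 (R : realType) (n : nat) :
  (forall (k d : nat) (theta : opE R n d), bounded_op theta ->
    [/\ (outer theta ->
           at0 theta \in unitmx /\
           (forall psi : opE R n d, bounded_op psi -> Kth psi = Kth theta ->
              forall hs : seq 'I_n -> 'cV[R[i]]_d,
                (sqnorm (Pk k (Mop psi k hs)) <= sqnorm (Pk k (Mop theta k hs)))%E)),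
        (at0 theta \in unitmx /\
           (forall psi : opE R n d, bounded_op psi -> Kth psi = Kth theta ->
              forall hs : seq 'I_n -> 'cV[R[i]]_d,
                (sqnorm (Pk k (Mop psi k hs)) <= sqnorm (Pk k (Mop theta k hs)))%E) ->
         at0 theta \in unitmx /\ Delta (Kth theta) = adjM (at0 theta) *m at0 theta),
        (at0 theta \in unitmx /\ Delta (Kth theta) = adjM (at0 theta) *m at0 theta ->
         at0 theta \in unitmx /\
           eK (Kth theta) = (ln (complex.Re (\det (adjM (at0 theta) *m at0 theta))))%:E) &
        (at0 theta \in unitmx /\
           eK (Kth theta) = (ln (complex.Re (\det (adjM (at0 theta) *m at0 theta))))%:E ->
         outer theta)]) /\
  (forall f : seq 'I_n -> R[i], inFock (fun a => (f a)%:M : 'cV[R[i]]_1) ->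
    (outer (scal_op f) <->
       f [::] != 0 /\
       eK (Kth (scal_op f)) =
         (ln (complex.Re (f [::]) ^+ 2 + complex.Im (f [::]) ^+ 2))%:E)).
Proof.
set P := (X in X /\ _); suff equiv : P.
  split=> // f If; have /bddP bf := bdd_scal_op If.
  (* Any [k] would do: only (ii) mentions it, and it is an intermediate step here. *)
  have [i_ii ii_iii iii_iv iv_i] := equiv 0 1 (scal_op f) bf.
  rewrite -unitmx_scal_op -Re_det_scal_op.
  by split=> [/i_ii /ii_iii /iii_iv|/iv_i].
move=> k d theta /bddP bt.
have sqE (A : opE R n d) hs : sqnorm (Pk k (Mop A k hs)) =
    (rip (trunc k.+1 (convol A (trunc k.+1 hs))) (trunc k.+1 (convol A (trunc k.+1 hs))))%:E.
  by rewrite MopE PkE; apply: sqnorm_rip; apply: inF_trunc.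
split.
- move=> ot; split=> [|psi /bddP bpsi K hs]; first exact: outer_unitmx.
  by rewrite !sqE lee_fin; apply: outer_maximal.
- move=> [ut Hmax]; split=> //; apply: (@Delta_of_maximal _ _ _ _ bt k ut) => psi bpsi K hs.
  have := Hmax psi ((bddP psi).2 bpsi) K hs.
  by rewrite (sqE psi) (sqE theta) lee_fin.
- by move=> [ut DE]; split=> //; rewrite /eK DE Re_det_gram_gt0.
- move=> [ut eE]; apply: outer_of_det => //.
  by apply: eK_eq_ln => //; apply: Re_det_gram_gt0.
Qed.
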